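(* Let $\kappa\in(0,1]$. For $\mathcal X_n=(X_n,d^{X_n},\rho_{X_n},\mu_{X_n})$, $n\in\mathbb N$, and $\mathcal X=(X,d^X,\rho_X,\mu_X)$ in $\mathfrak M_\bullet(\tau)$, the following conditions are equivalent to each other. (i) There exist a rooted boundedly compact metric space $(M,d^M,\rho_M)$ and root-preserving isometric embeddings $f_n:X_n\to M$, $f:X\to M$ such that $f_n(X_n)\to f(X)$ in the Fell topology, and $\mu_{X_n}\circ f_n^{-1}\to\mu_X\circ f^{-1}$ vaguely. (ii) There exist a boundedly compact metric space $(M,d^M)$ and isometric embeddings $f_n:X_n\to M$, $f:X\to M$ such that $f_n(X_n)\to f(X)$ in the Fell topology, $f_n(\rho_{X_n})\to f(\rho_X)$ in $M$, and $\mu_{X_n}\circ f_n^{-1}\to\mu_X\circ f^{-1}$ vaguely. (iii) $d^{\tau,\mathrm{BL}^\kappa}_{\mathfrak M_\bullet}(\mathcal X_n,\mathcal X)\to0$. (iv) The sequence $(\mathcal X_n)_n$ converges to $\mathcal X$ in the Gromov-Hausdorff-vague topology.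
   Context: A metric space is boundedly compact if every closed bounded subset is compact. A root-and-measured boundedly compact metric space is $(X,d^X,\rho_X,\mu_X)$ with $(X,d^X)$ a (non-empty) boundedly compact metric space, $\rho_X\in X$ a root and $\mu_X$ a Radon measure on $X$. Two such are equivalent if there is a root-preserving isometry from one onto the other pushing the first measure to the second. $\mathfrak M_\bullet(\tau)$ is a set of such spaces containing exactly one representative of each equivalence class. A map is root-preserving if it maps the root to the root. For a rooted boundedly compact space $(Z,d^Z,\rho_Z)$, $D(\rho_Z,r)=\{z:d^Z(\rho_Z,z)\le r\}$. For closed $A,B\subseteq Z$, $d^{Z,\rho_Z}_{\mathrm H}(A,B)=\int_0^\infty e^{-r}\bigl(1\wedge d^Z_{\mathrm H}(A\cap D(\rho_Z,r),B\cap D(\rho_Z,r))\bigr)dr$, where $d^Z_{\mathrm H}$ is the Hausdorff (extended) distance, $d^Z_{\mathrm H}(A,B)=\inf\{\varepsilon>0:A\subseteq B^\varepsilon,B\subseteq A^\varepsilon\}$ with $\inf\emptyset=\infty$. The topology induced by $d^{Z,\rho_Z}_{\mathrm H}$ on closed subsets does not depend on $\rho_Z$ and is the Fell topology. For finite Radon measures on $Z$, $d^Z_{\mathrm{BL}^\kappa}(\mu,\nu)=\sup\{|\int f\,d(\mu-\nu)|:\|f\|_{\mathrm{BL}^\kappa(Z)}\le1\}$, $\|f\|_{\mathrm{BL}^\kappa(Z)}=\sup_Z|f|+\sup_{x\ne y}|f(x)-f(y)|/d^Z(x,y)^\kappa$. For Radon measures on $Z$, $d^{Z,\rho_Z}_{\mathrm{BL}^\kappa}(\mu,\nu)=\int_0^\infty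 e^{-r}\bigl(1\wedge d^Z_{\mathrm{BL}^\kappa}(\mu(\cdot\cap D(\rho_Z,r)),\nu(\cdot\cap D(\rho_Z,r)))\bigr)dr$. $d^{\tau,\mathrm{BL}^\kappa}_{\mathfrak M_\bullet}(\mathcal X,\mathcal Y)=\inf_{f,g,Z}\{d^{Z,\rho_Z}_{\mathrm H}(f(X),g(Y))\vee d^{Z,\rho_Z}_{\mathrm{BL}^\kappa}(\mu_X\circ f^{-1},\mu_Y\circ g^{-1})\}$, the infimum over all rooted boundedly compact metric spaces $(Z,d^Z,\rho_Z)$ and root-preserving isometric embeddings $f:X\to Z$, $g:Y\to Z$. Gromov-Hausdorff-vague topology: the standard topology on (equivalence classes of) root-and-measured boundedly compact spaces; the paper describes its convergence by: all spaces can be isometrically embedded in a common boundedly compact metric space so that the images converge in the Fell topology, the roots converge, and the push-forward measures converge vaguely. *)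

(* Defs.v *)
From HB Require Import structures.
From mathcomp Require Import all_boot all_order all_algebra.
From mathcomp Require Import all_classical all_reals all_analysis.

Set Implicit Arguments.
Unset Strict Implicit.
Unset Printing Implicit Defensive.

Import Order.TTheory GRing.Theory Num.Theory.
Import numFieldNormedType.Exports.

Local Open Scope classical_set_scope.
Local Open Scope ring_scope.

(* Non-empty metric spaces. MathComp-Analysis requires the carrier of a
   sigma-algebra to be pointed; the distinguished [point] only witnesses
   non-emptiness. Roots are separate data, unrelated to [point]. *)
#[short(type="pmetricType")]
HB.structure Definition PointedMetric (R : numDomainType) :=
  { M of Metric R M & isPointed M }.

Notation borel T := (g_sigma_algebraType (@open T)).

Section metric_spaces.
Context {R : realType}.

Definition mbounded (M : metricType R) (A : set M) :=
  exists (x : M) (r : R), A `<=` [set y | mdist x y <= r].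

Definition boundedly_compact (M : metricType R) :=
  forall A : set M, closed A -> mbounded A -> compact A.

Definition isometric (X Y : metricType R) (f : X -> Y) :=
  forall x y, mdist (f x) (f y) = mdist x y.

Definition disc (Z : metricType R) (rho : Z) (r : R) : set Z :=
  [set z | mdist rho z <= r].

Definition thicken (Z : metricType R) (A : set Z) (e : R) : set Z :=
  [set z | exists2 a, A a & mdist a z < e].

Definition radon (M : pmetricType R) (mu : {measure set (borel M) -> \bar R}) :=
  (forall K : set M, compact K -> (mu K < +oo)%E) /\
  (forall A : set (borel M), measurable A ->
     mu A = ereal_sup [set mu K | K in [set K : set M | compact K /\ K `<=` A]]).

End metric_spaces.

(* The Fell topology, on all subsets of T; the hyperspace of closed subsets of T
   carries its restriction, so that for closed sets convergence here is
   convergence in the usual Fell topology. *)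
Definition fell (T : topologicalType) : Type := set T.

Section fell_topology.
Variable T : topologicalType.

Definition fell_subbase : set (set (set T)) :=
  [set V | (exists2 K : set T, compact K & V = [set F | F `&` K = set0]) \/
           (exists2 U : set T, open U & V = [set F | F `&` U !=set0])].

HB.instance Definition _ := Choice.copy (fell T) (set T).
HB.instance Definition _ :=
  @isSubBaseTopological.Build (fell T) (set (set T)) fell_subbase id.

End fell_topology.

(* Measures on a space M enter the next definitions as set functions, so as to
   apply directly to [pushforward] and to restrictions. *)
Section distances.
Context {R : realType}.
Local Open Scope ereal_scope.

Definition vague_cvg (M : pmetricType R) (mu_ : nat -> set (borel M) -> \bar R)
    (mu : set (borel M) -> \bar R) :=
  forall phi : M -> R, continuous phi ->
    compact (closure [set x | phi x != 0%R]) ->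
    (fun n => \int[mu_ n]_x (phi x)%:E) @ \oo --> \int[mu]_x (phi x)%:E.

Definition hausdorff_dist (Z : metricType R) (A B : set Z) : \bar R :=
  ereal_inf [set e%:E | e in [set e : R |
    [/\ (0 < e)%R, A `<=` thicken B e & B `<=` thicken A e]]].

(* e^{-r}-weighted integral, over r in [0, +oo[, of a truncated distance *)
Definition exp_average (D : R -> \bar R) : \bar R :=
  \int[lebesgue_measure]_(r in `[0%R, +oo[) ((expR (- r))%:E * mine 1 (D r)).

Definition rooted_hausdorff_dist (Z : metricType R) (rho : Z) (A B : set Z) :=
  exp_average (fun r =>
    hausdorff_dist (A `&` disc rho r) (B `&` disc rho r)).

(* The maximum with 0 only matters when Z is a single point, where the second
   supremum is over the empty set. *)
Definition BL_norm (kappa : R) (Z : metricType R) (f : Z -> R) : \bar R :=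
  ereal_sup [set `|f x|%:E | x in setT] +
  maxe 0 (ereal_sup [set (`|f p.1 - f p.2| / mdist p.1 p.2 `^ kappa)%:E
                      | p in [set p : Z * Z | p.1 != p.2]]).

Definition BL_dist (kappa : R) (Z : pmetricType R)
    (mu nu : set (borel Z) -> \bar R) : \bar R :=
  ereal_sup [set `| \int[mu]_x (f x)%:E - \int[nu]_x (f x)%:E |
              | f in [set f : Z -> R | BL_norm kappa f <= 1]].

Definition rooted_BL_dist (kappa : R) (Z : pmetricType R) (rho : Z)
    (mu nu : set (borel Z) -> \bar R) :=
  exp_average (fun r => BL_dist kappa (fun A => mu (A `&` disc rho r))
                                      (fun A => nu (A `&` disc rho r))).

End distances.

(* Root-and-measured boundedly compact metric spaces. *)
Record rmbc (R : realType) := Rmbc {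
  carrier :> pmetricType R ;
  rmbc_bc : boundedly_compact carrier ;
  rmbc_root : carrier ;
  rmbc_meas : {measure set (borel carrier) -> \bar R} ;
  rmbc_radon : radon rmbc_meas
}.

Section gromov_hausdorff_vague.
Context {R : realType}.

Definition image_meas (X : rmbc R) (M : pmetricType R) (f : X -> M)
    : set (borel M) -> \bar R :=
  pushforward (rmbc_meas X) (f : borel X -> borel M).

Definition rmbc_equiv (X Y : rmbc R) :=
  exists f : X -> Y, [/\ isometric f, range f = setT, f (rmbc_root X) = rmbc_root Y &
    forall A : set (borel Y), measurable A -> image_meas f A = rmbc_meas Y A].

Definition rooted_embedding_cvg (X_ : nat -> rmbc R) (X : rmbc R) :=
  exists (M : pmetricType R) (rho : M) (f_ : forall n, X_ n -> M) (f : X -> M),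
    [/\ boundedly_compact M,
        (forall n, isometric (f_ n) /\ f_ n (rmbc_root (X_ n)) = rho),
        isometric f /\ f (rmbc_root X) = rho,
        (fun n => range (f_ n) : fell M) @ \oo --> (range f : fell M) &
        vague_cvg (fun n => image_meas (f_ n)) (image_meas f)].

Definition embedding_cvg (X_ : nat -> rmbc R) (X : rmbc R) :=
  exists (M : pmetricType R) (f_ : forall n, X_ n -> M) (f : X -> M),
    [/\ boundedly_compact M,
        (forall n, isometric (f_ n)) /\ isometric f,
        (fun n => range (f_ n) : fell M) @ \oo --> (range f : fell M),
        (fun n => f_ n (rmbc_root (X_ n))) @ \oo --> f (rmbc_root X) &
        vague_cvg (fun n => image_meas (f_ n)) (image_meas f)].

Definition rmbc_dist (kappa : R) (X Y : rmbc R) : \bar R :=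
  ereal_inf [set e | exists (Z : pmetricType R) (rho : Z)
                            (f : X -> Z) (g : Y -> Z),
    [/\ boundedly_compact Z,
        isometric f /\ f (rmbc_root X) = rho,
        isometric g /\ g (rmbc_root Y) = rho &
        e = maxe (rooted_hausdorff_dist rho (range f) (range g))
                 (rooted_BL_dist kappa rho (image_meas f) (image_meas g))]].

(* The Gromov-Hausdorff-vague topology. It is metrizable, hence determined by
   its convergent sequences: a set of (equivalence classes of) spaces is open
   iff it is sequentially open for convergence in a common ambient space. That
   [embedding_cvg] is conversely implied by convergence in this topology is not
   part of the definition. *)
Definition GHv_open : set (set (rmbc R)) :=
  [set U | (forall X Y, rmbc_equiv X Y -> U X -> U Y) /\
           (forall (X_ : nat -> rmbc R) X, U X -> embedding_cvg X_ X ->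
              \forall n \near \oo, U (X_ n))].

Lemma GHv_openT : GHv_open setT.
Proof. by split=> // X_ X _ _; exact: nearW. Qed.

Lemma GHv_openI : setI_closed GHv_open.
Proof.
move=> U V [eU oU] [eV oV]; split=> [X Y XY [UX VX]|X_ X [UX VX] cX].
  by split; [exact: eU XY UX|exact: eV XY VX].
by apply: filterI; [exact: oU cX|exact: oV cX].
Qed.

Lemma GHv_open_bigU (I : Type) (F : I -> set (rmbc R)) :
  (forall i, GHv_open (F i)) -> GHv_open (\bigcup_i F i).
Proof.
move=> oF; split=> [X Y XY [i _ FiX]|X_ X [i _ FiX] cX].
  by exists i => //; exact: (oF i).1 XY FiX.
by apply: filterS ((oF i).2 _ _ FiX cX) => n FiXn; exists i.
Qed.

HB.instance Definition _ := gen_eqMixin (rmbc R).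
HB.instance Definition _ := gen_choiceMixin (rmbc R).
HB.instance Definition _ := isOpenTopological.Build (rmbc R)
  GHv_openT GHv_openI GHv_open_bigU.

End gromov_hausdorff_vague.

(* Main.v *)
Require Import Defs.
From HB Require Import structures.
From mathcomp Require Import all_boot all_order all_algebra.
From mathcomp Require Import all_classical all_reals all_analysis.
From mathcomp Require Import measurable_realfun lra.

(** The four conditions are compared with a fifth one, closeness, which refers to
    no ambient space. Two rooted measured spaces are close at scale [e] when
    some coupling of their distances matches the roots, matches points up to [e]
    within discs of radius [e^-1], and almost preserves the integrals of Lipschitz
    functions supported in these discs ([ghv_close]). This relation satisfies a
    triangle inequality ([ghv_close_trans]): couplings compose, and a pair of test
    functions on the extreme spaces extends by McShane's formula to the middle
    one.

    Convergence in a common space implies closeness even if the roots are not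
    matched ([embedding_ghv_close]): Fell convergence is Hausdorff approximation
    within discs, vague convergence is uniform over equicontinuous families
    with support in a disc ([vague_uniform]), and the distance of the roots, which
    tends to zero, can be added to the coupling before identifying them.
    Conversely, if the spaces of a sequence become close to [X], gluing all of
    them along [X] by means of the couplings yields a boundedly compact space with
    matched roots, in which they converge ([ghv_close_rooted_embedding]).

    For the distance, closeness is necessary since a small weighted average over
    the radii forces a small distance of the restrictions at some large radius
    ([dist_ghv_close]). In the other direction, in a common rooted space the
    distances of the restrictions to a disc tend to zero for all radii but
    countably many: exceptional are the radii of spheres charged by the limit
    measure ([BL_dist_disc_cvg]) and those at which the intersection of the limit
    set with discs jumps ([hausdorff_dist_disc_cvg]). Dominated convergence
    concludes; as measurability of the integrands in the radius is unclear, it is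
    applied to simple functions below them ([exp_average_cvg0]).

    Convergence in the Gromov-Hausdorff-vague topology follows from convergence in
    a common space by definition of the open sets. For the converse, an open
    neighborhood of [X] made of spaces close to [X] is needed. The endpoints of
    chains of spaces that start at [X] and whose steps decrease geometrically form
    one ([GHv_ghv_close]), thanks to the triangle inequality. *)

Import Order.TTheory GRing.Theory Num.Theory.
Import numFieldNormedType.Exports.

Local Open Scope classical_set_scope.
Local Open Scope ring_scope.

Set Implicit Arguments.
Unset Strict Implicit.
Unset Printing Implicit Defensive.

(** * Metric preliminaries *)

Section metric.
Context {R : realType}.
Implicit Types M X Y Z : metricType R.

Lemma mdist_sub M (a x y : M) : `|mdist a x - mdist a y| <= mdist x y.
Proof.
rewrite ler_norml; have := metric_triangle a x y; have := metric_triangle a y x.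
by rewrite (metric_sym y x) => ? ?; apply/andP; split; lra.
Qed.

Lemma continuous_mdistP M (f : M -> R) :
  (forall x (e : R), 0 < e -> exists2 d : R, 0 < d &
     forall y, mdist x y < d -> `|f x - f y| < e) -> continuous f.
Proof.
move=> h x; apply/cvgrPdist_lt => e e0; have [d d0 hd] := h x e e0.
near=> y; apply: hd; near: y.
by apply/metricType_numDomainType.nbhs_mdistP; exists d.
Unshelve. all: by end_near. Qed.

Definition lipschitz1 M (f : M -> R) := forall x y, `|f x - f y| <= mdist x y.

Lemma lipschitz_continuous M (k : R) (f : M -> R) :
  (forall x y, `|f x - f y| <= k * mdist x y) -> continuous f.
Proof.
move=> h; apply: continuous_mdistP => x e e0; exists (e / (`|k| + 1)).
  by rewrite divr_gt0// ltr_wpDl.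
move=> y; rewrite ltr_pdivlMr ?ltr_wpDl// => xy.
rewrite (le_lt_trans (h x y))// (le_lt_trans _ xy)// mulrC ler_wpM2l ?mdist_ge0//.
by rewrite (le_trans (ler_norm k))// lerDl.
Qed.

Lemma lipschitz1_continuous M (f : M -> R) : lipschitz1 f -> continuous f.
Proof. by move=> h; apply: (@lipschitz_continuous _ 1) => x y; rewrite mul1r. Qed.

Lemma mdist_continuous M (a : M) : continuous (mdist a).
Proof. by apply: lipschitz1_continuous => x y; exact: mdist_sub. Qed.

Lemma isometric_continuous X Y (f : X -> Y) : isometric f -> continuous f.
Proof.
move=> h x; apply/metricType_numDomainType.cvgrPdist_lt => e e0.
near=> y; rewrite h; near: y.
by apply/metricType_numDomainType.nbhs_mdistP; exists e.
Unshelve. all: by end_near. Qed.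

Lemma isometric_lipschitz1 X Y (f : X -> Y) (h : Y -> R) :
  isometric f -> lipschitz1 h -> lipschitz1 (h \o f).
Proof. by move=> hf hh x y; rewrite /= -(hf x y). Qed.

Lemma disc_closed M (a : M) r : closed (disc a r).
Proof.
apply: (@closed_comp _ _ (mdist a) [set x | x <= r]); last exact: closed_le.
by move=> x _; exact: mdist_continuous.
Qed.

Lemma disc_bounded M (a : M) r : mbounded (disc a r).
Proof. by exists a, r. Qed.

Lemma disc_compact M (a : M) r : boundedly_compact M -> compact (disc a r).
Proof. by apply; [exact: disc_closed|exact: disc_bounded]. Qed.

Lemma open_thicken M (A : set M) e : open (thicken A e).
Proof.
rewrite openE => x [a Aa axe]; apply/metricType_numDomainType.nbhs_mdistP.
exists (e - mdist a x); first by rewrite /= subr_gt0.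
by move=> y /= xy; exists a => //; rewrite (le_lt_trans (metric_triangle a x y))//; lra.
Qed.

Lemma compact_sub_disc M (a : M) (K : set M) : compact K ->
  exists r : R, K `<=` disc a r.
Proof.
move=> cK; have := (@compact_near_coveringP _ K).1 cK _ (pinfty_nbhs R)
  (fun r x => mdist a x <= r) _.
case=> [x Kx|r [_ hr]].
  near=> y r => /=; rewrite (le_trans (metric_triangle a x y))//.
  have xy : mdist x y < 1.
    by near: y; apply/metricType_numDomainType.nbhs_mdistP; exists 1 => /=.
  have : mdist a x + 1 <= r by near: r; apply: nbhs_pinfty_ge; rewrite num_real.
  by lra.
by exists (r + 1) => x Kx; apply: hr Kx; rewrite ltrDl.
Unshelve. all: by end_near. Qed.

Lemma compact_thicken M (K U : set M) : compact K -> open U -> K `<=` U ->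
  exists2 e : R, 0 < e & thicken K e `<=` U.
Proof.
move=> cK oU KU.
have : \forall e \near (0 : R)^'+, K `<=` [set x | forall y, mdist x y < e -> U y].
  apply: ((@compact_near_coveringP _ K).1 cK _ _
    (fun e x => forall y, mdist x y < e -> U y)) => x Kx.
  have /metricType_numDomainType.nbhs_mdistP [d /= d0 hd] : nbhs x U.
    by apply: open_nbhs_nbhs; split=> //; exact: KU.
  near=> x' e => y /= xy; apply: hd => /=.
  rewrite (le_lt_trans (metric_triangle x x' y))//.
  have : mdist x x' < d / 2.
    near: x'; apply/metricType_numDomainType.nbhs_mdistP.
    by exists (d / 2) => //=; rewrite divr_gt0.
  have : e < d / 2 by near: e; apply: nbhs_right_lt; rewrite divr_gt0.
  by lra.
move=> H; near (0 : R)^'+ => e; exists e => //.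
move=> y [x Kx xy]; suff /(_ x Kx) : K `<=` [set x | forall y, mdist x y < e -> U y].
  exact.
by near: e.
Unshelve. all: by end_near. Qed.

(** Only [x] is confined to the compact set, which is what allows the bound to
    be used across the boundary of the support of a function. *)
Lemma compact_unif_continuous M (K : set M) (h : M -> R) (e : R) : 0 < e ->
  compact K -> continuous h ->
  exists2 d : R, 0 < d & forall x y, K x -> mdist x y < d -> `|h x - h y| < e.
Proof.
move=> e0 cK ch.
have : \forall d \near (0 : R)^'+,
    K `<=` [set x | forall y, mdist x y < d -> `|h x - h y| < e].
  apply: ((@compact_near_coveringP _ K).1 cK _ _
    (fun d x => forall y, mdist x y < d -> `|h x - h y| < e)) => x Kx.
  have /metricType_numDomainType.nbhs_mdistP [d /= d0 hd] :
      \forall y \near x, `|h x - h y| < e / 2.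
    by have /cvgrPdist_lt := ch x; apply; rewrite divr_gt0.
  near=> x' d' => y /= xy.
  have xx' : mdist x x' < d / 2.
    near: x'; apply/metricType_numDomainType.nbhs_mdistP.
    by exists (d / 2) => //=; rewrite divr_gt0.
  have dd' : d' < d / 2 by near: d'; apply: nbhs_right_lt; rewrite divr_gt0.
  have h1 : `|h x - h x'| < e / 2 by apply: hd => /=; lra.
  have h2 : `|h x - h y| < e / 2.
    by apply: hd => /=; rewrite (le_lt_trans (metric_triangle x x' y))//; lra.
  have -> : h x' - h y = (h x - h y) - (h x - h x') by lra.
  by rewrite (le_lt_trans (ler_normB _ _))//; lra.
move=> H; near (0 : R)^'+ => d; exists d => //.
by move=> x y Kx; move: x Kx y; near: d.
Unshelve. all: by end_near. Qed.

Lemma compact_net (M : pmetricType R) (K : set M) (e : R) : 0 < e -> compact K ->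
  exists s : seq M, forall x, K x -> exists2 a, a \in s & mdist a x < e.
Proof.
move=> e0; rewrite compact_cover => /(_ M K (fun a => [set x | mdist a x < e])).
case=> [a Ka|x Kx|D _ hD].
- rewrite openE => x /= ax; apply/metricType_numDomainType.nbhs_mdistP.
  exists (e - mdist a x); first by rewrite /= subr_gt0.
  by move=> y /= xy; rewrite (le_lt_trans (metric_triangle a x y))//; lra.
- by exists x => //=; rewrite mdistxx.
- by exists (finmap.enum_fset D) => x /hD [a /= aD ax]; exists a.
Qed.

End metric.

(** * Integrals of bounded functions with bounded support *)

Section borel.
Context {R : realType}.
Implicit Types M N : pmetricType R.

Lemma open_borel M (A : set M) : open A -> measurable (A : set (borel M)).
Proof. exact: sub_sigma_algebra. Qed.

Lemma closed_borel M (A : set M) : closed A -> measurable (A : set (borel M)).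
Proof.
move=> cA; rewrite -(setCK A); apply: measurableC.
by apply: open_borel; rewrite openC.
Qed.

Lemma continuous_borel_real M (f : M -> R) : continuous f ->
  measurable_fun [set: borel M] (f : borel M -> R).
Proof.
move=> cf; apply: (measurability _ (RGenOInfty.measurableE R)).
move=> _ [_ [a ->] <-]; rewrite setTI; apply: open_borel.
apply: open_comp => [x _|]; first exact: cf.
exact: interval_open.
Qed.

Lemma continuous_borel M N (f : M -> N) : continuous f ->
  measurable_fun [set: borel M] (f : borel M -> borel N).
Proof.
move=> cf; apply: (@measurability _ _ (borel M) (borel N) _ _ (@open N)) => //.
move=> _ [A oA <-]; rewrite setTI; apply: open_borel.
by apply: open_comp => // x _; exact: cf.
Qed.

Lemma disc_borel M (a : M) r : measurable (disc a r : set (borel M)).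
Proof. by apply: closed_borel; exact: disc_closed. Qed.

(** Functions integrable against every Borel measure that is finite on
    discs. *)
Definition tame M (F : M -> R) :=
  measurable_fun [set: borel M] (F : borel M -> R) /\
  exists B a r, forall x, `|F x| <= B /\ (F x != 0 -> mdist a x <= r).

Lemma tameB M (F G : M -> R) : tame F -> tame G -> tame (fun x => F x - G x).
Proof.
move=> [mF [B [a [r hF]]]] [mG [B' [a' [r' hG]]]]; split.
  exact: measurable_funB.
exists (B + B'), a, (Num.max r (mdist a a' + r')) => x; split.
  by rewrite (le_trans (ler_normB _ _))// lerD// ?(hF x).1 ?(hG x).1.
have [Fx0|Fx0] := eqVneq (F x) 0; last first.
  by rewrite le_max (hF x).2.
rewrite Fx0 sub0r oppr_eq0 => /(hG x).2 h; rewrite le_max; apply/orP; right.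
by rewrite (le_trans (metric_triangle a a' x))// lerD2l.
Qed.

Lemma tameM M (F G : M -> R) : tame F ->
  measurable_fun [set: borel M] (G : borel M -> R) ->
  (exists B, forall x, `|G x| <= B) -> tame (fun x => F x * G x).
Proof.
move=> [mF [B [a [r hF]]]] mG [B' hG]; split; first exact: measurable_funM.
exists (B * B'), a, r => x; split; first by rewrite normrM ler_pM ?(hF x).1.
by rewrite mulf_eq0 negb_or => /andP[+ _]; exact: (hF x).2.
Qed.

Lemma tameZ M (c : R) (F : M -> R) : tame F -> tame (fun x => c * F x).
Proof.
move=> tF; under eq_fun do rewrite mulrC.
by apply: tameM => //; exists `|c|.
Qed.

Lemma tame_continuous M (F : M -> R) B a r : continuous F ->
  (forall x, `|F x| <= B) -> (forall x, F x != 0 -> mdist a x <= r) -> tame F.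
Proof.
move=> /continuous_borel_real mF FB Fr; split=> //.
by exists B, a, r => x; split; [exact: FB|exact: Fr].
Qed.

Lemma tame_comp M N (f : N -> M) (F : M -> R) : isometric f ->
  tame F -> tame (F \o f).
Proof.
move=> hf [mF [B [a [r hF]]]]; split.
  exact: (measurableT_comp mF (continuous_borel (isometric_continuous hf))).
exists B, (point : N), (mdist a (f point) + r) => x; split; first exact: (hF _).1.
move=> /(hF _).2 h; rewrite -hf (le_trans (metric_triangle _ a _))// lerD//.
by rewrite metric_sym.
Qed.

End borel.

Section intg.
Context {R : realType}.
Implicit Types X : rmbc R.

(** All integrals are pulled back to the spaces themselves, where the measure
    is genuine, rather than computed against set functions on an ambient
    space. *)
Definition intg X (F : X -> R) : R :=
  Rintegral (rmbc_meas X) setT (F : borel X -> R).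

Lemma disc_measure_fin X (a : X) r : (rmbc_meas X (disc a r) < +oo)%E.
Proof. exact: ((rmbc_radon X).1 _ (disc_compact (@rmbc_bc _ X))). Qed.

Lemma tame_integrable X (F : X -> R) : tame F ->
  (rmbc_meas X).-integrable [set: borel X] (EFin \o F).
Proof.
move=> [mF [B [a [r hF]]]].
have -> : EFin \o F = (EFin \o F) \_ (disc a r : set (borel X)).
  apply/funext => x; rewrite patchE; case: ifPn => //.
  rewrite notin_setE /disc/= => /negP; rewrite -ltNge => h.
  by apply: contraTeq h => /eqP/eqP; rewrite eqe -leNgt => /(hF x).2.
have mD := disc_borel a r.
apply/(integrable_mkcond _ mD); apply: (measurable_bounded_integrable mD).
- exact: disc_measure_fin.
- exact: measurable_funTS.
- exists B; split; first exact: num_real.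
  by move=> z Bz x _ /=; rewrite (le_trans (hF x).1)// ltW.
Qed.

Lemma intgE X (F : X -> R) : tame F ->
  (\int[rmbc_meas X]_x (F x)%:E = (intg F)%:E)%E.
Proof.
by move=> /tame_integrable/integrable_fin_num h; rewrite fineK//; exact: h.
Qed.

Lemma intgB X (F G : X -> R) : tame F -> tame G ->
  intg (fun x => F x - G x) = intg F - intg G.
Proof. by move=> ? ?; rewrite /intg RintegralB//; exact: tame_integrable. Qed.

Lemma intgZ X (c : R) (F : X -> R) : tame F ->
  intg (fun x => c * F x) = c * intg F.
Proof. by move=> ?; rewrite /intg RintegralZl//; exact: tame_integrable. Qed.

Lemma le_intg X (F G : X -> R) : tame F -> tame G -> (forall x, F x <= G x) ->
  intg F <= intg G.
Proof.
by move=> ? ? FG; apply: le_Rintegral => //; exact: tame_integrable.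
Qed.

Lemma intg_ge0 X (F : X -> R) : (forall x, 0 <= F x) -> 0 <= intg F.
Proof. by move=> F0; apply: Rintegral_ge0. Qed.

Lemma dist_intg X (F G H : X -> R) : tame F -> tame G -> tame H ->
  (forall x, `|F x - G x| <= H x) -> `|intg F - intg G| <= intg H.
Proof.
move=> tF tG tH FGH; rewrite -intgB//.
have tFG := tameB tF tG; rewrite ler_norml; apply/andP; split.
  rewrite -mulN1r -intgZ//; apply: le_intg => //; first exact: tameZ.
  by move=> x; have := FGH x; rewrite ler_norml mulN1r => /andP[].
by apply: le_intg => // x; have := FGH x; rewrite ler_norml => /andP[].
Qed.

Lemma integral_image X (M : pmetricType R) (f : X -> M) (F : M -> R) :
  isometric f -> tame F ->
  (\int[image_meas f]_x (F x)%:E = (intg (F \o f))%:E)%E.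
Proof.
move=> hf tF; have mf := continuous_borel (isometric_continuous hf).
rewrite -intgE; last exact: tame_comp.
rewrite /image_meas (@integral_pushforward _ _ _ _ _ _ mf _ _ (EFin \o F))//.
- by apply/measurable_EFinP; exact: tF.1.
- by rewrite preimage_setT; apply: tame_integrable; exact: tame_comp.
Qed.

Lemma tame_disc (M : pmetricType R) (a : M) r (F : M -> R) :
  measurable_fun [set: borel M] (F : borel M -> R) ->
  (exists B, forall x, `|F x| <= B) -> tame (F \_ (disc a r)).
Proof.
move=> mF [B FB]; split.
  by apply/(measurable_restrictT _ (disc_borel a r)); exact: measurable_funTS.
exists B, a, r => x; rewrite patchE; case: ifPn => [|_].
  by rewrite inE.
by rewrite normr0 eqxx (le_trans _ (FB x)).
Qed.

(** The set function on the left is a restriction of a pushforward; it charges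
    nothing outside of the disc, so that cutting [F] off there is harmless. *)
Lemma integral_image_disc X (M : pmetricType R) (f : X -> M) (F : M -> R) (a : M) r :
  isometric f -> measurable_fun [set: borel M] (F : borel M -> R) ->
  (exists B, forall x, `|F x| <= B) ->
  (\int[fun A : set (borel M) => image_meas f (A `&` disc a r)]_x (F x)%:E =
   (intg ((F \_ (disc a r)) \o f))%:E)%E.
Proof.
move=> hf mF FB; have mf := continuous_borel (isometric_continuous hf).
have mD := disc_borel a r.
have tF := tame_disc a r mF FB.
rewrite -integral_image//.
have nu0 : mrestr (pushforward (rmbc_meas X) (f : borel X -> borel M)) mD
    (~` disc a r) = 0%E.
  by rewrite /mrestr setICl measure0.
have fin (g : borel M -> R) : measurable_fun setT g -> (exists B, forall x, `|g x| <= B) ->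
    (mrestr (pushforward (rmbc_meas X) (f : borel X -> borel M)) mD).-integrable
     setT (EFin \o g).
  move=> mg [B gB]; apply: measurable_bounded_integrable => //.
  - change (rmbc_meas X (f @^-1` (setT `&` disc a r)) < +oo)%E; rewrite setTI.
    apply: (@le_lt_trans _ _ (rmbc_meas X (disc (point : X) (mdist a (f point) + r)))).
      apply: le_measure; rewrite ?inE.
      + by rewrite -[X in measurable X]setTI; exact: mf.
      + exact: disc_borel.
      + move=> x; rewrite /disc /= => h; rewrite -hf.
        by rewrite (le_trans (metric_triangle _ a _))// lerD// metric_sym.
    exact: disc_measure_fin.
  - exists B; split; first exact: num_real.
    by move=> z Bz x _ /=; rewrite (le_trans (gB x))// ltW.
have mC : measurable (~` disc a r : set (borel M)) by exact: measurableC.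
transitivity (\int[mrestr (pushforward (rmbc_meas X) (f : borel X -> borel M)) mD]_x
   (F x)%:E)%E => //.
rewrite (negligible_integral mC)//; last exact: fin.
rewrite setTD setCK.
rewrite (eq_measure_integral (pushforward (rmbc_meas X) (f : borel X -> borel M))).
  rewrite integral_mkcond; apply: eq_integral => x _ /=.
  by rewrite restrict_EFin.
by move=> A mA AD; rewrite /mrestr; congr (pushforward _ _ _); exact: setIidl.
Qed.

End intg.

(** * Lipschitz extensions and cutoff functions *)

Section mcshane.
Context {R : realType} (I : Type) (Z : metricType R).
Variables (v : I -> R) (D : I -> Z -> R).

(** McShane's extension of prescribed values [v i], truncated below at [0];
    [D i z] is the distance from [z] to the place where [v i] is prescribed. *)
Definition mcshane (z : Z) : R :=
  sup ([set 0] `|` range (fun i => v i - D i z)).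

Hypothesis D0 : forall i z, 0 <= D i z.
Hypothesis v1 : forall i, v i <= 1.

Let mcshane_ubound z : has_ubound ([set 0] `|` range (fun i => v i - D i z)).
Proof.
exists 1 => _ [->|[i _ <-]]; first exact: ler01.
by have := D0 i z; have := v1 i; lra.
Qed.

Lemma mcshane_ge i z : v i - D i z <= mcshane z.
Proof. by apply: ub_le_sup => //; right; exists i. Qed.

Lemma mcshane_ge0 z : 0 <= mcshane z.
Proof. by apply: ub_le_sup => //; left. Qed.

Lemma mcshane_le z c : 0 <= c -> (forall i, v i - D i z <= c) -> mcshane z <= c.
Proof.
move=> c0 h; apply: ge_sup; first by exists 0; left.
by move=> _ [->//|[i _ <-]].
Qed.

Lemma mcshane_le1 z : mcshane z <= 1.
Proof.
by apply: mcshane_le => // i; have := D0 i z; have := v1 i; lra.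
Qed.

Lemma mcshane_lipschitz1 :
  (forall i z z', D i z' <= D i z + mdist z z') -> lipschitz1 mcshane.
Proof.
move=> Dt; suff h z z' : mcshane z <= mcshane z' + mdist z z'.
  move=> z z'; rewrite ler_norml; have := h z z'; have := h z' z.
  by rewrite (metric_sym z' z) => ? ?; apply/andP; split; lra.
apply: mcshane_le; first by rewrite addr_ge0 ?mcshane_ge0 ?mdist_ge0.
by move=> i; have := mcshane_ge i z'; have := Dt i z z'; lra.
Qed.

Lemma mcshane_support z : mcshane z != 0 -> exists i, D i z < v i.
Proof.
apply: contra_neqP => h; apply/eqP; rewrite eq_le mcshane_ge0 andbT.
apply: mcshane_le => // i; rewrite leNgt; apply/negP => iz; apply: h.
by exists i; move: iz; rewrite subr_gt0.
Qed.

End mcshane.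

Section cutoff.
Context {R : realType}.

Definition clamp (t : R) : R := Num.max 0 (Num.min 1 t).

Lemma clamp01 t : 0 <= clamp t <= 1.
Proof. by rewrite le_max lexx ge_max ler01 ge_min lexx. Qed.

Lemma clamp_lip s t : `|clamp s - clamp t| <= `|s - t|.
Proof.
have := ler_norm (s - t); have := ler_norm (t - s); rewrite (distrC t s) => ? ?.
rewrite /clamp ler_norml; case: (leP 1 s) => ?; case: (leP 1 t) => ?;
  case: (leP 0 s) => ?; case: (leP 0 t) => ?; rewrite ?(max_idPr (@ler01 R));
  apply/andP; split; lra.
Qed.

Lemma clamp1 t : 1 <= t -> clamp t = 1.
Proof. by move=> t1; rewrite /clamp (min_idPl t1); apply/max_idPr. Qed.

Lemma clamp_neq0 t : clamp t != 0 -> 0 < t.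
Proof.
apply: contraNT; rewrite -leNgt => t0; apply/eqP/max_idPl.
by rewrite ge_min t0 orbT.
Qed.

Definition plateau (M : metricType R) (a : M) r x := clamp (r + 1 - mdist a x).

Lemma plateau01 (M : metricType R) (a : M) r x : 0 <= plateau a r x <= 1.
Proof. exact: clamp01. Qed.

Lemma plateau_lipschitz1 (M : metricType R) (a : M) r : lipschitz1 (plateau a r).
Proof.
move=> x y; rewrite (le_trans (clamp_lip _ _))//.
have -> : r + 1 - mdist a x - (r + 1 - mdist a y) = mdist a y - mdist a x by lra.
by rewrite (metric_sym x y) mdist_sub.
Qed.

Lemma plateau1 (M : metricType R) (a : M) r x : mdist a x <= r -> plateau a r x = 1.
Proof. by move=> h; rewrite /plateau clamp1//; lra. Qed.

Lemma plateau_neq0 (M : metricType R) (a : M) r x :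
  plateau a r x != 0 -> mdist a x <= r + 1.
Proof. by move=> /clamp_neq0; lra. Qed.

Lemma tame_plateau (M : pmetricType R) (a : M) r : tame (plateau a r).
Proof.
apply: (@tame_continuous _ _ _ 1 a (r + 1)).
- exact/lipschitz1_continuous/plateau_lipschitz1.
- by move=> x; have /andP[? ?] := plateau01 a r x; rewrite ger0_norm.
- by move=> x; exact: plateau_neq0.
Qed.

End cutoff.

(** * Fell convergence *)

Section fell.
Context {R : realType}.

Lemma fell_subbase_open (T : topologicalType) (V : set (set T)) :
  fell_subbase V -> open (V : set (fell T)).
Proof.
move=> sV; exists [set V]; last by rewrite bigcup_set1.
move=> _ ->; exists (finmap.fset1 V).
  by move=> W; rewrite finmap.inE => /eqP ->; exact/mem_set.
apply/seteqP; split=> F /=; first by apply; rewrite /= finmap.inE.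
by move=> VF W; rewrite /= finmap.inE => /eqP ->.
Qed.

Lemma fell_cvg (T : topologicalType) (F : set_system (fell T)) (A : set T) :
  Filter F -> (forall V, fell_subbase V -> V A -> F V) -> F --> (A : fell T).
Proof.
move=> FF h W /=; rewrite nbhsE => -[U [[D hD <-] [B DB BA]] UW].
apply: (filterS UW); have [D' D'sub D'E] := hD _ DB.
apply: (@filterS _ F FF B); first by move=> S BS; exists B.
rewrite -D'E; apply: filter_bigI => V D'V; apply: h.
  by have := D'sub _ D'V => /set_mem.
by move: BA; rewrite -D'E; exact.
Qed.

Lemma fell_cvg_hit (T : topologicalType) (A_ : nat -> set T) (A U : set T) :
  (fun n => A_ n : fell T) @ \oo --> (A : fell T) -> open U -> A `&` U !=set0 ->
  \forall n \near \oo, A_ n `&` U !=set0.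
Proof.
move=> cA oU AU; apply: (cA [set F | F `&` U !=set0]).
apply: open_nbhs_nbhs; split=> //; apply: fell_subbase_open.
by right; exists U.
Qed.

Lemma fell_cvg_miss (T : topologicalType) (A_ : nat -> set T) (A K : set T) :
  (fun n => A_ n : fell T) @ \oo --> (A : fell T) -> compact K -> A `&` K = set0 ->
  \forall n \near \oo, A_ n `&` K = set0.
Proof.
move=> cA cK AK; apply: (cA [set F | F `&` K = set0]).
apply: open_nbhs_nbhs; split=> //; apply: fell_subbase_open.
by left; exists K.
Qed.

(** The part of a disc that is not within [e] of [A] is a compact set missed by
    [A], hence eventually missed by [A_ n]. *)
Lemma fell_cvg_thicken_sub (M : pmetricType R) (A_ : nat -> set M) (A : set M) (a : M) r e :
  boundedly_compact M -> (fun n => A_ n : fell M) @ \oo --> (A : fell M) -> 0 < e ->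
  \forall n \near \oo, A_ n `&` disc a r `<=` thicken A e.
Proof.
move=> bM cA e0; have := @fell_cvg_miss _ A_ A (disc a r `&` ~` thicken A e) cA.
case=> [||n _ hn].
- apply: compact_closedI; first exact: disc_compact.
  by apply: open_closedC; exact: open_thicken.
- rewrite -subset0 => x [Ax [_]]; apply.
  by exists x => //; rewrite mdistxx.
- exists n => // k /hn h x [Ax dx]; apply: contrapT => nx.
  by have : set0 x by rewrite -[set0]h.
Qed.

(** Finitely many balls of radius [e / 2] cover the disc, and those that meet
    [A] eventually meet [A_ n]. *)
Lemma fell_cvg_sub_thicken (M : pmetricType R) (A_ : nat -> set M) (A : set M) (a : M) r e :
  boundedly_compact M -> (fun n => A_ n : fell M) @ \oo --> (A : fell M) -> 0 < e ->
  \forall n \near \oo, A `&` disc a r `<=` thicken (A_ n) e.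
Proof.
move=> bM cA e0; have e20 : 0 < e / 2 by rewrite divr_gt0.
have [s hs] := compact_net e20 (disc_compact (a := a) (r := r) bM).
have h (i : 'I_(size s)) : \forall n \near \oo,
    A `&` [set x | mdist (nth a s i) x < e / 2] !=set0 ->
    A_ n `&` [set x | mdist (nth a s i) x < e / 2] !=set0.
  have [AU|nAU] := pselect (A `&` [set x | mdist (nth a s i) x < e / 2] !=set0).
    have := fell_cvg_hit cA _ AU; case=> [|n _ hn].
      rewrite openE => x /= ax; apply/metricType_numDomainType.nbhs_mdistP.
      exists (e / 2 - mdist (nth a s i) x); first by rewrite /= subr_gt0.
      move=> y /= xy; rewrite (le_lt_trans (metric_triangle _ x y))//.
      by move: xy; lra.
    by exists n => // k /hn.
  by apply: nearW.
have ff : Filter (nbhs \oo) by exact _.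
have {}h := @filter_forall _ _ _ (nbhs \oo) ff h.
apply: filterS h => n hn x [Ax dx].
have [b /[dup] bs /(nthP a)[i si ib] bx] := hs x dx.
have : A `&` [set x | mdist (nth a s i) x < e / 2] !=set0 by exists x; rewrite /= ib.
move/(hn (Ordinal si)) => -[y [Ay]]; rewrite /= ib => yb.
exists y => //; rewrite (le_lt_trans (metric_triangle _ b x))//.
by rewrite (metric_sym y b); lra.
Qed.

End fell.

(** * Vague convergence of image measures *)

Section vague.
Context {R : realType}.

Definition bounded_support (M : metricType R) (phi : M -> R) :=
  exists (a : M) (r : R), forall x, phi x != 0 -> mdist a x <= r.

Lemma bounded_support_bounded (M : pmetricType R) (phi : M -> R) :
  boundedly_compact M -> continuous phi -> bounded_support phi ->
  exists2 B, 0 < B & forall x, `|phi x| <= B.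
Proof.
move=> bM cphi [a [r h]].
have : compact (phi @` disc a r).
  apply: continuous_compact; last exact: disc_compact.
  exact: continuous_subspaceT.
move=> /compact_bounded [B [_ hB]].
exists (`|B| + 1); first by rewrite ltr_wpDl.
move=> x; have [->|/h ax] := eqVneq (phi x) 0; first by rewrite normr0 ltW// ltr_wpDl.
apply: hB; last by exists x.
by rewrite (le_lt_trans (ler_norm B))// ltrDl.
Qed.

Lemma bounded_support_tame (M : pmetricType R) (phi : M -> R) :
  boundedly_compact M -> continuous phi -> bounded_support phi -> tame phi.
Proof.
move=> bM cphi sphi; have [B _ hB] := bounded_support_bounded bM cphi sphi.
by case: sphi => a [r h]; apply: (tame_continuous cphi hB h).
Qed.

Lemma bounded_supportP (M : pmetricType R) (phi : M -> R) : boundedly_compact M ->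
  compact (closure [set x | phi x != 0]) <-> bounded_support phi.
Proof.
move=> bM; split => [/(compact_sub_disc point)[r h]|[a [r h]]].
  by exists point, r => x phix; apply: h; exact: subset_closure.
apply: bM; first exact: closed_closure.
exists a, r; rewrite [X in _ `<=` X](closure_id _).1; last exact: disc_closed.
by apply: closure_subset => x; exact: h.
Qed.

Variables (X_ : nat -> rmbc R) (X : rmbc R) (M : pmetricType R).
Variables (f_ : forall n, X_ n -> M) (f : X -> M).
Hypothesis bM : boundedly_compact M.
Hypothesis isof_ : forall n, isometric (@f_ n).
Hypothesis isof : isometric f.

Definition vague_intg := forall phi : M -> R, continuous phi ->
  bounded_support phi -> intg (phi \o @f_ n) @[n --> \oo] --> intg (phi \o f).

Lemma vague_cvgP :
  vague_cvg (fun n => image_meas (@f_ n)) (image_meas f) <-> vague_intg.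
Proof.
split=> [h phi cphi sphi|h phi cphi /(bounded_supportP _ bM) sphi].
  have tphi := bounded_support_tame bM cphi sphi.
  have := h phi cphi ((bounded_supportP _ bM).2 sphi).
  rewrite integral_image//.
  under eq_fun do rewrite integral_image//.
  by move/fine_cvg.
have tphi := bounded_support_tame bM cphi sphi.
rewrite integral_image//.
under eq_fun do rewrite integral_image//.
by apply: cvg_EFin; [exact: nearW|exact: h].
Qed.

Hypothesis vf : vague_intg.

Lemma vague_intg_le (phi : M -> R) (c : R) : continuous phi -> bounded_support phi ->
  intg (phi \o f) < c -> \forall n \near \oo, intg (phi \o @f_ n) < c.
Proof.
move=> cphi sphi phic; have := vf cphi sphi => /cvgrPdist_lt.
move=> /(_ (c - intg (phi \o f))); rewrite subr_gt0 => /(_ phic).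
by apply: filterS => n; rewrite ltr_norml => /andP[]; lra.
Qed.

(** Such a family is totally bounded for the uniform distance, so that up to a
    small uniform error it may be replaced by a finite one; the error is
    controlled by the bounded masses of a slightly larger disc. *)
Lemma vague_uniform (a : M) r (Fam : set (M -> R)) :
  (forall F, Fam F -> forall x, `|F x| <= 1) ->
  (forall F, Fam F -> forall x, F x != 0 -> mdist a x <= r) ->
  (forall e : R, 0 < e -> exists2 d : R, 0 < d & forall F, Fam F ->
      forall x y, mdist x y < d -> `|F x - F y| < e) ->
  forall e : R, 0 < e -> \forall n \near \oo, forall F, Fam F ->
    `|intg (F \o @f_ n) - intg (F \o f)| <= e.
Proof.
move=> Fam1 Famr Fame e e0.
have Famc F : Fam F -> continuous F.
  move=> FF; apply: continuous_mdistP => x eta /Fame[d d0 hd].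
  by exists d => // y; exact: hd.
have Famt F : Fam F -> tame F.
  by move=> FF; apply: (@tame_continuous _ _ _ 1 a r);
    [exact: Famc|exact: Fam1|exact: Famr].
pose psi := plateau a r.
have cpsi : continuous psi by exact/lipschitz1_continuous/plateau_lipschitz1.
have spsi : bounded_support psi by exists a, (r + 1) => x; exact: plateau_neq0.
pose B := intg (psi \o f) + 1.
have B0 : 0 < B.
  by rewrite ltr_wpDl// intg_ge0// => x; have /andP[] := plateau01 a r (f x).
pose eta := e / (4 * B).
have eta0 : 0 < eta by rewrite divr_gt0// mulr_gt0.
have eta30 : 0 < eta / 3 by rewrite divr_gt0.
have [d d0 hd] := Fame _ eta30.
have [s hs] := compact_net d0 (disc_compact (a := a) (r := r) bM).
(* Functions are encoded by their values at the net [s], rounded to a grid of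
   step [eta / 3]; [rep] picks one member of the family for each code. *)
pose K := (Num.trunc (2 / (eta / 3))).+1.
pose cell (F : M -> R) (i : nat) := Num.trunc ((F (nth a s i) + 1) / (eta / 3)).
pose code (F : M -> R) : {ffun 'I_(size s) -> 'I_K.+1} :=
  [ffun i : 'I_(size s) => inord (cell F i)].
pose rep (c : {ffun 'I_(size s) -> 'I_K.+1}) :=
  xget (cst 0) [set F | Fam F /\ code F = c].
have cellK F i : Fam F -> (cell F i < K.+1)%N.
  move=> FF; rewrite ltnS; apply: leqW; apply: le_truncn.
  rewrite ler_wpM2r ?invr_ge0 ?(ltW eta30)//.
  by have := Fam1 _ FF (nth a s i); rewrite ler_norml => /andP[]; lra.
have repP F : Fam F -> Fam (rep (code F)) /\ forall x, `|F x - rep (code F) x| <= eta * psi x.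
  move=> FF; have := @xgetPex _ (cst 0) [set G | Fam G /\ code G = code F].
  case=> [|Frep cE]; first by exists F.
  rewrite -/(rep (code F)) in Frep cE *; set G := rep (code F) in Frep cE *.
  split=> // x; have [xr|xr] := leP (mdist a x) r; last first.
    have F0 : F x = 0.
      by apply: contraTeq xr => /(Famr _ FF); rewrite -leNgt.
    have G0 : G x = 0.
      by apply: contraTeq xr => /(Famr _ Frep); rewrite -leNgt.
    rewrite F0 G0 subrr normr0 mulr_ge0 ?(ltW eta0)//.
    by have /andP[] := plateau01 a r x.
  rewrite /psi plateau1// mulr1.
  have [b /(nthP a)[i si ib] bx] := hs x xr.
  have FGb : `|F b - G b| <= eta / 3.
    have : cell G i = cell F i.
      have := congr1 (fun c : {ffun _ -> _} => nat_of_ord (c (Ordinal si))) cE.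
      by rewrite !ffunE /= !inordK ?cellK.
    rewrite /cell ib => cGF.
    have pos H : Fam H -> 0 <= (H b + 1) / (eta / 3).
      move=> HH; rewrite divr_ge0 ?(ltW eta30)//.
      by have := Fam1 _ HH b; rewrite ler_norml => /andP[]; lra.
    have /andP[f1 f2] := truncn_itv (pos _ FF).
    have /andP[g1 g2] := truncn_itv (pos _ Frep).
    rewrite cGF in g1 g2; move: f1 f2 g1 g2.
    rewrite ler_pdivlMr// ler_pdivlMr// ltr_pdivrMr// ltr_pdivrMr//.
    rewrite -addn1 natrD mulrDl mul1r.
    by move=> *; rewrite ler_norml; apply/andP; split; lra.
  have := hd _ FF _ _ bx; have := hd _ Frep _ _ bx; move: FGb.
  rewrite ler_norml ltr_norml => /andP[? ?] /andP[? ?].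
  rewrite ltr_norml => /andP[? ?]; rewrite ler_norml; apply/andP; split; lra.
have ff : Filter (nbhs \oo) by exact _.
have h (c : {ffun 'I_(size s) -> 'I_K.+1}) : \forall n \near \oo, Fam (rep c) ->
    `|intg (rep c \o @f_ n) - intg (rep c \o f)| < e / 4.
  have [Fc|nFc] := pselect (Fam (rep c)); last by apply: nearW.
  have sc : bounded_support (rep c) by exists a, r; exact: Famr.
  have e40 : 0 < e / 4 by rewrite divr_gt0.
  have /cvgrPdist_lt/(_ _ e40) := vf (Famc _ Fc) sc.
  by apply: filterS => n; rewrite distrC.
have {}h := @filter_forall _ _ _ (nbhs \oo) ff h.
have hB : intg (psi \o f) < B by rewrite ltrDl.
have {}hB := vague_intg_le cpsi spsi hB.
apply: filterS2 h hB => n hn hB F FF.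
have [Frep Feta] := repP F FF.
have tpsi : tame psi by exact: tame_plateau.
have est (Y : rmbc R) (g : Y -> M) : isometric g -> intg (psi \o g) <= B ->
    `|intg (F \o g) - intg (rep (code F) \o g)| <= e / 4.
  move=> isog gB; apply: (@le_trans _ _ (intg (fun x => eta * (psi \o g) x))).
    apply: dist_intg => [|||x]; last exact: Feta.
    - exact/tame_comp/Famt.
    - exact/tame_comp/Famt.
    - exact/tameZ/tame_comp.
  rewrite intgZ; last exact: tame_comp.
  rewrite (le_trans (ler_wpM2l (ltW eta0) gB))// /eta.
  by rewrite invfM -!mulrA mulVf ?gt_eqF// mulr1.
have h1 := est _ _ (@isof_ n) (ltW hB).
have h2 : `|intg (F \o f) - intg (rep (code F) \o f)| <= e / 4.
  by apply: est => //; rewrite lerDl.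
have := hn (code F) Frep; move: h1 h2.
rewrite !ler_norml ltr_norml => /andP[? ?] /andP[? ?] /andP[? ?].
by apply/andP; split; lra.
Qed.

End vague.

(** * Couplings of rooted measured spaces *)

Section infsum.
Context {R : realType} (I : pointedType).
Implicit Types p q : I -> R.

(** Length of the shortest detour through [I], for given distances to [I]. *)
Definition infsum p q : R := inf (range (fun i => p i + q i)).

Lemma infsum_le p q i : (forall i, 0 <= p i) -> (forall i, 0 <= q i) ->
  infsum p q <= p i + q i.
Proof.
move=> p0 q0; apply: ge_inf; last by exists i.
by exists 0 => _ [j _ <-]; rewrite addr_ge0.
Qed.

Lemma infsum_ge p q c : (forall i, c <= p i + q i) -> c <= infsum p q.
Proof.
move=> h; apply: lb_le_inf; first by exists (p point + q point), point.
by move=> _ [j _ <-].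
Qed.

Lemma infsumC p q : infsum p q = infsum q p.
Proof. by rewrite /infsum; under eq_fun do rewrite addrC. Qed.

End infsum.

Section coupling.
Context {R : realType}.

(** [delta] extends the distances of [X] and [Y] to a pseudometric on their
    disjoint union. *)
Definition coupling (X Y : metricType R) (delta : X -> Y -> R) :=
  [/\ forall x x' y, delta x y <= mdist x x' + delta x' y,
      forall x y y', delta x y <= delta x y' + mdist y' y,
      forall x x' y, mdist x x' <= delta x y + delta x' y &
      forall x y y', mdist y y' <= delta x y + delta x y'].

Lemma coupling_ge0 (X Y : metricType R) (delta : X -> Y -> R) x y :
  coupling delta -> 0 <= delta x y.
Proof. by case=> _ _ /(_ x x y) + _; rewrite mdistxx; lra. Qed.

Implicit Types X Y Z : rmbc R.

Definition rooted_coupling X Y (delta : X -> Y -> R) :=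
  coupling delta /\ delta (rmbc_root X) (rmbc_root Y) = 0.

Lemma rooted_coupling_dist X Y (delta : X -> Y -> R) x y :
  rooted_coupling delta -> mdist (rmbc_root Y) y <= mdist (rmbc_root X) x + delta x y.
Proof.
move=> [[d1 d2 d3 d4] d0].
have := d4 x (rmbc_root Y) y; have := d1 x (rmbc_root X) (rmbc_root Y).
by rewrite d0 (metric_sym x); lra.
Qed.

Lemma coupling_sym X Y (delta : X -> Y -> R) :
  rooted_coupling delta -> rooted_coupling (fun y x => delta x y).
Proof.
move=> [[d1 d2 d3 d4] d0]; split=> //; split => *; last exact: d3.
- by rewrite addrC metric_sym; exact: d2.
- by rewrite addrC metric_sym; exact: d1.
- exact: d4.
Qed.

Lemma mdist_rooted X : rooted_coupling (fun x y : X => mdist x y).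
Proof.
split; last exact: mdistxx.
split=> [x x' z|x z z'|x x' z|x z z'] /=; try exact: metric_triangle.
  by rewrite (metric_sym x' z); exact: metric_triangle.
by rewrite (metric_sym x z); exact: metric_triangle.
Qed.

(** Gluing at the roots only. *)
Definition wedge_coupling X Y (x : X) (y : Y) : R :=
  mdist x (rmbc_root X) + mdist (rmbc_root Y) y.

Lemma wedge_rooted X Y : rooted_coupling (@wedge_coupling X Y).
Proof.
rewrite /wedge_coupling; split; last by rewrite !mdistxx addr0.
split=> [x x' y|x y y'|x x' y|x y y'].
- by have := metric_triangle x x' (rmbc_root X); lra.
- by have := metric_triangle (rmbc_root Y) y' y; lra.
- have := metric_triangle x (rmbc_root X) x'; have := mdist_ge0 (rmbc_root Y) y.
  by rewrite (metric_sym x' (rmbc_root X)); lra.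
- have := metric_triangle y (rmbc_root Y) y'; have := mdist_ge0 x (rmbc_root X).
  by rewrite (metric_sym y (rmbc_root Y)); lra.
Qed.

Definition comp_coupling X Y Z (d : X -> Y -> R) (d' : Y -> Z -> R) x z :=
  infsum (d x) (d' ^~ z).

Lemma comp_rooted X Y Z (d : X -> Y -> R) (d' : Y -> Z -> R) :
  rooted_coupling d -> rooted_coupling d' -> rooted_coupling (comp_coupling d d').
Proof.
move=> [cd d0] [cd' d'0]; have [d1 d2 d3 d4] := cd; have [d'1 d'2 d'3 d'4] := cd'.
have p0 x y : 0 <= d x y by exact: coupling_ge0.
have q0 y z : 0 <= d' y z by exact: coupling_ge0.
have le x y z : comp_coupling d d' x z <= d x y + d' y z by exact: infsum_le.
split; last first.
  apply/eqP; rewrite eq_le; apply/andP; split.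
    by rewrite (le_trans (le _ (rmbc_root Y) _))// d0 d'0 addr0.
  by apply: infsum_ge => y /=; rewrite addr_ge0.
split=> [x x' z|x z z'|x x' z|x z z'].
- rewrite -lerBlDl; apply: infsum_ge => y /=.
  by have := le x y z; have := d1 x x' y; lra.
- rewrite -lerBlDr; apply: infsum_ge => y /=.
  by have := le x y z; have := d'2 y z z'; lra.
- rewrite -lerBlDr; apply: infsum_ge => y /=; rewrite lerBlDr addrC -lerBlDr.
  apply: infsum_ge => y' /=.
  have := d3 x x' y'; have := d2 x y' y; have := d'3 y y' z.
  by rewrite (metric_sym y y'); lra.
- rewrite -lerBlDr; apply: infsum_ge => y /=; rewrite lerBlDr addrC -lerBlDr.
  apply: infsum_ge => y' /=.
  have := d'4 y z z'; have := d'1 y y' z'; have := d4 x y y'.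
  by rewrite (metric_sym y y'); lra.
Qed.

Definition test (e : R) X (f : X -> R) :=
  [/\ forall x, 0 <= f x <= 1, lipschitz1 f &
      forall x, f x != 0 -> mdist (rmbc_root X) x <= e^-1].

(** The radius [e^-1] and the precision [e] are tied together so that a single
    parameter indexes the relation. The measures are compared through pairs of
    functions compatible with the coupling: these are the traces of Lipschitz
    functions on the coupled disjoint union, so that only couplings, and no
    ambient spaces, have to be composed. *)
Definition coupling_within (e : R) X Y (delta : X -> Y -> R) :=
  [/\ rooted_coupling delta,
      forall x, mdist (rmbc_root X) x <= e^-1 -> exists y, delta x y < e,
      forall y, mdist (rmbc_root Y) y <= e^-1 -> exists x, delta x y < e &
      forall f g, test e f -> test e g -> (forall x y, `|f x - g y| <= delta x y) ->
        `|intg f - intg g| <= e].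

Definition ghv_close e X Y := exists delta, @coupling_within e X Y delta.

Lemma test_tame e X (f : X -> R) : test e f -> tame f.
Proof.
move=> [f01 lf sf]; apply: (@tame_continuous _ _ _ 1 (rmbc_root X) e^-1) => //.
  exact: lipschitz1_continuous.
by move=> x; have /andP[? ?] := f01 x; rewrite ger0_norm.
Qed.

Lemma coupling_within_le e e' X Y (delta : X -> Y -> R) : 0 < e -> e <= e' ->
  coupling_within e delta -> coupling_within e' delta.
Proof.
move=> e0 ee' [rd h1 h2 h3]; have e'0 : 0 < e' by exact: lt_le_trans ee'.
have ve : e'^-1 <= e^-1 by rewrite lef_pV2.
split=> // [x xe|y ye|f g].
- by have [y xy] := h1 x (le_trans xe ve); exists y; exact: lt_le_trans ee'.
- by have [x xy] := h2 y (le_trans ye ve); exists x; exact: lt_le_trans ee'.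
- move=> [f01 lf sf] [g01 lg sg] fg; apply: le_trans ee'; apply: h3 => //.
    by split=> // x /sf /le_trans; apply.
  by split=> // x /sg /le_trans; apply.
Qed.

Lemma ghv_close_le e e' X Y : 0 < e -> e <= e' -> ghv_close e X Y -> ghv_close e' X Y.
Proof. by move=> ? ? [d h]; exists d; exact: coupling_within_le h. Qed.

Lemma ghv_close_refl e X : 0 < e -> ghv_close e X X.
Proof.
move=> e0; exists (fun x y => mdist x y); split.
- exact: mdist_rooted.
- by move=> x _; exists x; rewrite mdistxx.
- by move=> x _; exists x; rewrite mdistxx.
- move=> f g _ _ fg; suff -> : f = g by rewrite subrr normr0 ltW.
  apply/funext => x; apply/eqP; rewrite -subr_eq0 -normr_le0.
  by rewrite (le_trans (fg x x))// mdistxx.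
Qed.

(** A test pair on [X] and [Z] extends by McShane's formula to a test function
    on [Y] compatible with both. Its support grows by at most [1], as test
    functions are bounded by [1]; passing from [e] to [2 * e] pays for this. *)
Lemma ghv_close_trans e X Y Z : 0 < e -> e <= 2^-1 ->
  ghv_close e X Y -> ghv_close e Y Z -> ghv_close (2 * e) X Z.
Proof.
move=> e0 e12 [d [rd h1 h2 h3]] [d' [rd' h1' h2' h3']].
have ve : (2 * e)^-1 + 1 <= e^-1.
  rewrite invfM; suff : 2 <= e^-1 by lra.
  by rewrite -[leLHS]invrK lef_pV2// posrE.
have p0 x y : 0 <= d x y by apply: coupling_ge0; exact: rd.1.
have q0 y z : 0 <= d' y z by apply: coupling_ge0; exact: rd'.1.
have [d1 d2 d3 d4] := rd.1; have [d'1 d'2 d'3 d'4] := rd'.1.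
have le x y z : comp_coupling d d' x z <= d x y + d' y z by exact: infsum_le.
exists (comp_coupling d d'); split; first exact: comp_rooted.
- move=> x xe; have [|y xy] := h1 x; first by lra.
  have [|z yz] := h1' y.
    by have := rooted_coupling_dist x y rd; lra.
  by exists z; rewrite (le_lt_trans (le x y z))//; lra.
- move=> z ze; have [|y yz] := h2' z; first by lra.
  have [|x xy] := h2 y.
    by have := rooted_coupling_dist z y (coupling_sym rd'); rewrite /=; lra.
  by exists x; rewrite (le_lt_trans (le x y z))//; lra.
move=> f h tf th fh; have [f01 lf sf] := tf; have [h01 lh sh] := th.
pose v (i : X + Z) := match i with inl x => f x | inr z => h z end.
pose D (i : X + Z) (y : Y) := match i with inl x => d x y | inr z => d' y z end.
have D0 i y : 0 <= D i y by case: i => [x|z] /=.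
have v1 i : v i <= 1 by case: i => [x|z]; [have /andP[] := f01 x|have /andP[] := h01 z].
pose g := mcshane v D.
have g01 y : 0 <= g y <= 1 by rewrite mcshane_ge0// mcshane_le1.
have fg x y : `|f x - g y| <= d x y.
  have := @mcshane_ge _ _ _ v D D0 v1 (inl x) y; rewrite -/g /= => ?.
  have : g y <= f x + d x y.
    apply: mcshane_le => [|i].
      by rewrite addr_ge0//; have /andP[] := f01 x.
    case: i => [x'|z] /=.
      have := lf x' x; have := d3 x' x y; rewrite ler_norml => ? /andP[? ?].
      by lra.
    have := fh x z; have := le x y z; rewrite ler_norml => ? /andP[? ?]; lra.
  by rewrite ler_norml => ?; apply/andP; split; lra.
have gh y z : `|g y - h z| <= d' y z.
  have := @mcshane_ge _ _ _ v D D0 v1 (inr z) y; rewrite -/g /= => ?.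
  have : g y <= h z + d' y z.
    apply: mcshane_le => [|i].
      by rewrite addr_ge0//; have /andP[] := h01 z.
    case: i => [x|z'] /=.
      have := fh x z; have := le x y z; rewrite ler_norml => ? /andP[? ?]; lra.
    have := lh z' z; have := d'4 y z' z; rewrite ler_norml => ? /andP[? ?].
    by lra.
  by rewrite ler_norml => ?; apply/andP; split; lra.
have tg : test e g.
  split=> //.
    apply: mcshane_lipschitz1 => // -[x|z] y y' /=; first exact: d2.
    by rewrite addrC (metric_sym y); exact: d'1.
  move=> y /mcshane_support[//|//|[x|z] /= h0].
    have fx0 : f x != 0 by rewrite gt_eqF// (le_lt_trans (p0 x y)).
    have := sf x fx0; have := rooted_coupling_dist x y rd.
    by have /andP[? ?] := f01 x; lra.
  have hz0 : h z != 0 by rewrite gt_eqF// (le_lt_trans (q0 y z)).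
  have := sh z hz0; have := rooted_coupling_dist z y (coupling_sym rd').
  by have /andP[? ?] := h01 z; rewrite /=; lra.
have t1 : `|intg f - intg g| <= e.
  by apply: h3 => //; split=> // x /sf; lra.
have t2 : `|intg g - intg h| <= e.
  by apply: h3' => //; split=> // x /sh; lra.
have -> : intg f - intg h = (intg f - intg g) + (intg g - intg h) by lra.
by rewrite (le_trans (ler_normD _ _))//; lra.
Qed.

(** The steps shrink so fast that the endpoint of a chain is close to its origin,
    whatever the length. The set of endpoints is open, which is not clear for
    the set of spaces related to [X] by [ghv_close e]: a chain can always be
    prolonged by one more, sufficiently small, step. *)
Fixpoint chain (k : nat) (e : R) X Y : Prop :=
  if k is k'.+1 then exists2 W, ghv_close (e / 2) W X & chain k' (e / 2) W Y
  else Y = X.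

Lemma chain_ghv_close k e X Y : 0 < e -> e <= 1 -> chain k e X Y -> ghv_close e Y X.
Proof.
elim: k e X => [|k IH] e X e0 e1 /=; first by move=> ->; exact: ghv_close_refl.
move=> [W WX WY].
have e20 : 0 < e / 2 by rewrite divr_gt0.
have -> : e = 2 * (e / 2) by lra.
by apply: (@ghv_close_trans _ _ W) => //; [lra|apply: IH => //; lra].
Qed.

Lemma chain_rcons k e X Y Y' : chain k e X Y -> ghv_close (e / 2 ^+ k.+1) Y' Y ->
  chain k.+1 e X Y'.
Proof.
elim: k e X => [|k IH] e X /=; first by move=> -> ?; exists Y'.
move=> [W WX WY]; rewrite exprS invfM mulrA => h.
by exists W => //; exact: IH.
Qed.

End coupling.

Section lipschitz_tests.
Context {R : realType}.

(** The approximation is the supremum over [y] of [phi y - C * mdist y x]: for a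
    large slope [C], only points [y] so close to [x] that [phi y] is nearly
    [phi x] contribute. *)
Lemma lipschitz_approx (M : pmetricType R) (phi : M -> R) (a : M) (r e : R) :
  boundedly_compact M -> continuous phi -> (forall x, 0 <= phi x) ->
  (forall x, phi x != 0 -> mdist a x <= r) -> 0 < e ->
  exists (C : R) (G : M -> R),
    [/\ 0 < C, lipschitz1 G, forall x, 0 <= G x <= 1,
        forall x, G x != 0 -> mdist a x <= r + 1 &
        forall x, `|phi x - C * G x| <= e].
Proof.
move=> bM cphi phi0 sphi e0.
have sphi' : bounded_support phi by exists a, r.
have [B B0 hB] := bounded_support_bounded bM cphi sphi'.
have [d d0 hd] := compact_unif_continuous e0 (disc_compact (a := a) (r := r) bM) cphi.
pose s := Num.min 1 d.
have s0 : 0 < s by rewrite lt_min ltr01.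
have s1 : s <= 1 by rewrite ge_min lexx.
have sd : s <= d by rewrite ge_min lexx orbT.
(* a slope at which a value of [phi] is forgotten within distance [s] *)
pose C := B / s.
have C0 : 0 < C by rewrite divr_gt0.
have CB : B <= C by rewrite ler_peMr ?(ltW B0)// invf_ge1.
have Cs : C * s = B by rewrite mulfVK// gt_eqF.
have phiB x : phi x <= B by rewrite (le_trans (ler_norm _)).
pose v := fun y => phi y / C.
pose G := mcshane v (fun y x : M => mdist y x).
have v1 y : v y <= 1 by rewrite ler_pdivrMr// mul1r (le_trans (phiB y)).
have D0 (y x : M) : 0 <= mdist y x by exact: mdist_ge0.
have far x y : mdist y x < v y -> phi y != 0 /\ mdist y x < s.
  rewrite /v ltr_pdivlMr// => yx.
  have y0 : 0 < phi y by rewrite (le_lt_trans _ yx)// mulr_ge0// ltW.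
  split; first by rewrite gt_eqF.
  rewrite -(ltr_pM2r C0) (lt_le_trans yx)// mulrC Cs; exact: phiB.
exists C, G; split => //.
- apply: mcshane_lipschitz1 => // y x x'; exact: metric_triangle.
- by move=> x; rewrite mcshane_ge0// mcshane_le1.
- move=> x /(mcshane_support D0 v1)[y] /far[/sphi yr yx].
  by rewrite (le_trans (metric_triangle a y x))//; lra.
- move=> x; have G1 : phi x <= C * G x.
    have := @mcshane_ge _ _ _ v _ D0 v1 x x; rewrite mdistxx subr0 /v -/v.
    by rewrite ler_pdivrMr// mulrC.
  have G2 : G x <= (phi x + e) / C.
    apply: mcshane_le => [|y].
      by rewrite divr_ge0 ?(ltW C0)// addr_ge0// ltW.
    have [yx|yx] := leP (v y) (mdist y x).
      rewrite (@le_trans _ _ 0) ?subr_le0// divr_ge0 ?(ltW C0)//.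
      by rewrite addr_ge0// ltW.
    have [/sphi yr ys] := far _ _ yx.
    have := hd y x yr (lt_le_trans ys sd); rewrite ltr_norml => /andP[_ h].
    rewrite (@le_trans _ _ (v y)) ?gerBl// /v ler_wpM2r ?invr_ge0 ?(ltW C0)//.
    by lra.
  move: G2; rewrite ler_pdivlMr// mulrC => G2.
  by rewrite ler_norml; apply/andP; split; lra.
Qed.

Variables (X_ : nat -> rmbc R) (X : rmbc R) (M : pmetricType R).
Variables (f_ : forall n, X_ n -> M) (f : X -> M).
Hypothesis bM : boundedly_compact M.
Hypothesis isof_ : forall n, isometric (@f_ n).
Hypothesis isof : isometric f.

(** The errors of Lipschitz approximation are uniform on a disc, and the masses
    of discs are bounded because a plateau function is itself Lipschitz. *)
Lemma vague_intg_lipschitz :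
  (forall G : M -> R, lipschitz1 G -> (forall x, 0 <= G x <= 1) ->
     bounded_support G -> intg (G \o @f_ n) @[n --> \oo] --> intg (G \o f)) ->
  vague_intg f_ f.
Proof.
move=> h.
have pos phi : continuous phi -> bounded_support phi -> (forall x, 0 <= phi x) ->
    intg (phi \o @f_ n) @[n --> \oo] --> intg (phi \o f).
  move=> cphi sphi phi0; have tphi := bounded_support_tame bM cphi sphi.
  have [a [r har]] := sphi.
  apply/cvgrPdist_le => e e0.
  pose psi := plateau a (r + 1).
  have tpsi : tame psi by exact: tame_plateau.
  have spsi : bounded_support psi by exists a, (r + 1 + 1) => x; exact: plateau_neq0.
  have hpsi : intg (psi \o @f_ n) @[n --> \oo] --> intg (psi \o f).
    by apply: h => //; [exact: plateau_lipschitz1|move=> x; exact: plateau01].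
  pose B := intg (psi \o f) + 1.
  have B0 : 0 < B.
    by rewrite ltr_wpDl// intg_ge0// => x; have /andP[] := plateau01 a (r + 1) (f x).
  pose eta := e / (4 * B).
  have eta0 : 0 < eta by rewrite divr_gt0// mulr_gt0.
  have [C [G [C0 lG G01 sG phiG]]] := lipschitz_approx bM cphi phi0 har eta0.
  have tG : tame G.
    apply: (@tame_continuous _ _ _ 1 a (r + 1)) => //; first exact: lipschitz1_continuous.
    by move=> x; have /andP[? ?] := G01 x; rewrite ger0_norm.
  have est (Y : rmbc R) (g : Y -> M) : isometric g -> intg (psi \o g) <= B ->
      `|intg (phi \o g) - C * intg (G \o g)| <= e / 4.
    move=> isog gB.
    rewrite -intgZ; last exact: tame_comp.
    apply: (@le_trans _ _ (intg (fun x => eta * (psi \o g) x))).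
      apply: dist_intg => [|||x].
      - exact: tame_comp.
      - by apply: tameZ; exact: tame_comp.
      - by apply: tameZ; exact: tame_comp.
      rewrite /=.
      have [xr|xr] := leP (mdist a (g x)) (r + 1).
        by rewrite /psi plateau1// mulr1; exact: phiG.
      have -> : phi (g x) = 0.
        by apply: contraTeq xr => /har; rewrite -leNgt; lra.
      have -> : G (g x) = 0 by apply: contraTeq xr => /sG; rewrite -leNgt.
      rewrite mulr0 subrr normr0 mulr_ge0 ?(ltW eta0)//.
      by have /andP[] := plateau01 a (r + 1) (g x).
    rewrite intgZ; last exact: tame_comp.
    rewrite (le_trans (ler_wpM2l (ltW eta0) gB))// /eta.
    by rewrite invfM -!mulrA mulVf ?gt_eqF// mulr1.
  have hG : intg (G \o @f_ n) @[n --> \oo] --> intg (G \o f).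
    by apply: h => //; exists a, (r + 1).
  have eC0 : 0 < e / (4 * C) by rewrite divr_gt0// mulr_gt0.
  move: hG => /cvgrPdist_lt/(_ _ eC0) hG.
  move: hpsi => /cvgrPdist_lt/(_ 1 ltr01) hpsi.
  near=> n.
  have h1 : `|intg (phi \o @f_ n) - C * intg (G \o @f_ n)| <= e / 4.
    apply: est; first exact: isof_.
    have : `|intg (psi \o f) - intg (psi \o @f_ n)| < 1 by near: n.
    by rewrite ltr_norml => /andP[? ?]; rewrite /B; lra.
  have h2 : `|intg (phi \o f) - C * intg (G \o f)| <= e / 4.
    by apply: est => //; rewrite lerDl.
  have h3 : `|C * intg (G \o f) - C * intg (G \o @f_ n)| <= e / 4.
    rewrite -mulrBr normrM gtr0_norm//.
    have : `|intg (G \o f) - intg (G \o @f_ n)| < e / (4 * C) by near: n.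
    rewrite ltr_pdivlMr ?mulr_gt0// => h4; rewrite ler_pdivlMr//.
    by rewrite mulrC mulrA mulrC ltW.
  move: h1 h2 h3; rewrite !ler_norml => /andP[? ?] /andP[? ?] /andP[? ?].
  by apply/andP; split; lra.
move=> phi cphi [a [r har]].
have cmax (h' : M -> R) : continuous h' -> continuous (fun x => Num.max (h' x) 0).
  move=> ch x; apply: (@continuous_max _ _ h' (cst 0) x (ch x)); exact: cvg_cst.
have cp := cmax _ cphi.
have cn : continuous (fun x => Num.max (- phi x) 0).
  by apply: cmax => x; apply: continuousN; exact: cphi.
have max0 (t : R) : Num.max t 0 != 0 -> t != 0.
  by apply: contraNneq => ->; rewrite maxxx.
have sp : bounded_support (fun x => Num.max (phi x) 0).
  by exists a, r => x /max0; exact: har.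
have sn : bounded_support (fun x => Num.max (- phi x) 0).
  by exists a, r => x /max0; rewrite oppr_eq0; exact: har.
have hp := pos _ cp sp (fun x => ltac:(by rewrite le_max lexx orbT)).
have hn := pos _ cn sn (fun x => ltac:(by rewrite le_max lexx orbT)).
have E (Y : rmbc R) (g : Y -> M) : isometric g -> intg (phi \o g) =
    intg ((fun x => Num.max (phi x) 0) \o g) - intg ((fun x => Num.max (- phi x) 0) \o g).
  move=> isog; rewrite -intgB; last 2 first.
  - exact/tame_comp/bounded_support_tame.
  - exact/tame_comp/bounded_support_tame.
  congr intg; apply/funext => x /=.
  by case: (leP (phi (g x)) 0) => ?; case: (leP (- phi (g x)) 0) => ?; lra.
rewrite E//; under eq_fun do rewrite E//.
exact: cvgB.
Unshelve. all: by end_near. Qed.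

End lipschitz_tests.

(** * Gluing a sequence of spaces along a limit space *)

Section ultra.
Context {R : realType} (M : metricType R).

(** Otherwise every point of [K] has a neighborhood outside of some member of
    [F], and by compactness a whole thickening of [K] misses a member of
    [F]. *)
Lemma ultra_thicken_cvg (F : set_system M) (K : set M) : UltraFilter F ->
  compact K -> (forall e : R, 0 < e -> F (thicken K e)) -> exists2 p, K p & F --> p.
Proof.
move=> UF cK FK; apply: contrapT => nh.
have FF : ProperFilter F by exact: ultra_proper.
have : \forall Se \near filter_prod (powerset_filter_from F) (0 : R)^'+,
    K `<=` [set p | forall y, Se.1 y -> ~ mdist p y < Se.2].
  apply: ((@compact_near_coveringP _ K).1 cK _
    (filter_prod (powerset_filter_from F) (0 : R)^'+)
    (fun (Se : set M * R) (p : M) => forall y, Se.1 y -> ~ mdist p y < Se.2)) => p Kp.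
  have [d d0 Fd] : exists2 d : R, 0 < d & F (~` [set y | mdist p y < d]).
    apply: contrapT => nd; apply: nh; exists p => // B.
    move=> /metricType_numDomainType.nbhs_mdistP[d /= d0 hd].
    have [Fd|Fd] := in_ultra_setVsetC [set y | mdist p y < d] UF.
      exact: filterS Fd.
    by exfalso; apply: nd; exists d.
  near=> p' Se => y /= Sy p'y.
  have pp' : mdist p p' < d / 2.
    near: p'; apply/metricType_numDomainType.nbhs_mdistP.
    by exists (d / 2) => //=; rewrite divr_gt0.
  have [S1 S2] : Se.1 `<=` ~` [set y | mdist p y < d] /\ Se.2 < d / 2.
    near: Se.
    exists ([set S | S `<=` ~` [set y | mdist p y < d]], [set t : R | t < d / 2]) => /=.
      split; last by apply: nbhs_right_lt; rewrite divr_gt0.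
      exact: small_set_sub Fd.
    by move=> [S t] [].
  apply: (S1 y Sy) => /=.
  by rewrite (le_lt_trans (metric_triangle p p' y))//; lra.
case=> -[P Q] /= [hP hQ] PQ.
have [S [FS PS]] : exists S, F S /\ P S.
  near (powerset_filter_from F) => S; exists S; split; last by near: S.
  by near: S; exact: near_small_set.
near (0 : R)^'+ => e.
have e0 : 0 < e by near: e; exact: nbhs_right_gt.
have Qe : Q e by near: e.
have [y [Sy [p Kp py]]] := filter_ex (filterI FS (FK e e0)).
by apply: (PQ (S, e) _ p Kp y).
Unshelve. all: by end_near. Qed.

End ultra.

(** ** The metric quotient of a pseudometric *)

Record pseudodist (R : realType) := Pseudodist {
  pd_sort : Type ;
  pd_point : pd_sort ;
  pd_dist : pd_sort -> pd_sort -> R ;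
  pd_distxx : forall x, pd_dist x x = 0 ;
  pd_dist_sym : forall x y, pd_dist x y = pd_dist y x ;
  pd_dist_triangle : forall y x z, pd_dist x z <= pd_dist x y + pd_dist y z
}.

Section quotient.
Context {R : realType} (P : pseudodist R).
Implicit Types s t : pd_sort P.

Lemma pd_dist_ge0 s t : 0 <= pd_dist s t.
Proof.
by have := pd_dist_triangle t s s; rewrite pd_distxx (pd_dist_sym t s); lra.
Qed.

Definition pd_repr t : pd_sort P :=
  xget (pd_point P : {classic pd_sort P}) [set u | pd_dist t u = 0].

Lemma pd_reprP t : pd_dist t (pd_repr t) = 0.
Proof. by rewrite /pd_repr; case: xgetP => [//|/(_ t)]; rewrite /= pd_distxx. Qed.

Lemma pd_repr_eq s t : pd_dist s t = 0 -> pd_repr s = pd_repr t.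
Proof.
move=> st; rewrite /pd_repr.
suff -> : [set u | pd_dist s u = 0] = [set u | pd_dist t u = 0] by [].
apply/funext => u; apply/propext => /=.
have := pd_dist_triangle s t u; have := pd_dist_triangle t s u.
rewrite (pd_dist_sym t s) st; have := pd_dist_ge0 s u; have := pd_dist_ge0 t u.
by move=> *; split=> ?; lra.
Qed.

(** Identifying points at distance zero amounts to keeping one representative
    per class, which avoids sets of classes. *)
Definition quot := {t : pd_sort P | pd_repr t = t}.

Lemma pd_reprK t : pd_repr (pd_repr t) = pd_repr t.
Proof. by apply/esym/pd_repr_eq; exact: pd_reprP. Qed.

Definition quot_pi t : quot := exist _ (pd_repr t) (pd_reprK t).

Definition quot_dist (a b : quot) := pd_dist (sval a) (sval b).

Lemma quot_dist_eq0 a b : quot_dist a b = 0 -> a = b.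
Proof.
by move=> /pd_repr_eq; case: a b => [a ra] [b rb] /= ab; apply/eq_exist; congruence.
Qed.

HB.instance Definition _ := gen_eqMixin quot.
HB.instance Definition _ := gen_choiceMixin quot.
HB.instance Definition _ := isPointed.Build quot (quot_pi (pd_point P)).
HB.instance Definition _ := @isMetric.Build R quot quot_dist
  (fun a => pd_distxx (sval a)) quot_dist_eq0
  (fun a b => pd_dist_sym (sval a) (sval b))
  (fun b a c => pd_dist_triangle (sval b) (sval a) (sval c)).

Lemma quot_mdist s t :
  mdist (quot_pi s : quot) (quot_pi t : quot) = pd_dist s t.
Proof.
change (pd_dist (pd_repr s) (pd_repr t) = pd_dist s t).
have := pd_dist_triangle (pd_repr s) s t; have := pd_dist_triangle (pd_repr t) (pd_repr s) t.
have := pd_dist_triangle s (pd_repr s) (pd_repr t).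
have := pd_dist_triangle t s (pd_repr t).
rewrite (pd_dist_sym (pd_repr s) s) (pd_dist_sym (pd_repr t) t) !pd_reprP; lra.
Qed.

Lemma quot_pi_surj (z : quot) : exists t, z = quot_pi t.
Proof.
exists (sval z); case: z => [t rt] /=; apply/eq_exist; by rewrite rt.
Qed.

End quotient.

(** ** The glued space *)

Section glue.
Context {R : realType} (Y : option nat -> rmbc R) (X : rmbc R).
Variable delta : forall i, Y i -> X -> R.
Hypothesis cdelta : forall i, coupling (@delta i).

Let T := {i : option nat & Y i}.
Let p (t : T) : X -> R := delta (tagged t).

Let p0 t x : 0 <= p t x.
Proof. by apply: coupling_ge0; exact: cdelta. Qed.

(** Points of distinct pieces are joined through [X]. *)
Definition glue_dist (s t : T) : R :=
  if tag s == tag t then mdist (tagged s) (tagged_as s t) else infsum (p s) (p t).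

Lemma glue_distE i (a b : Y i) : glue_dist (existT _ i a) (existT _ i b) = mdist a b.
Proof. by rewrite /glue_dist /= eqxx tagged_asE. Qed.

Lemma glue_distN s t : tag s != tag t -> glue_dist s t = infsum (p s) (p t).
Proof. by rewrite /glue_dist => /negbTE ->. Qed.

Let infsum_triangle s t u : infsum (p s) (p u) <= infsum (p s) (p t) + infsum (p t) (p u).
Proof.
rewrite -lerBlDr; apply: infsum_ge => x; rewrite lerBlDr addrC -lerBlDr.
apply: infsum_ge => y.
have := @infsum_le _ _ (p s) (p u) x (p0 s) (p0 u).
have [_ h2 _ h4] := cdelta (tag u); have := h2 (tagged u) x y.
have [_ _ _ h4'] := cdelta (tag t); have := h4' (tagged t) x y.
by rewrite /p (metric_sym x y); lra.
Qed.

Let infsum_mdist i (a b : Y i) (u : T) :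
  infsum (delta a) (p u) <= mdist a b + infsum (delta b) (p u).
Proof.
rewrite -lerBlDl; apply: infsum_ge => x.
have := @infsum_le _ _ (delta a) (p u) x (p0 (existT _ i a)) (p0 u).
have [h1 _ _ _] := cdelta i; have := h1 a b x; lra.
Qed.

Let mdist_infsum i (a b : Y i) (t : T) :
  mdist a b <= infsum (delta a) (p t) + infsum (p t) (delta b).
Proof.
apply: le_trans (infsum_triangle (existT _ i a) t (existT _ i b)).
apply: infsum_ge => x; have [_ _ h3 _] := cdelta i; exact: h3.
Qed.

Lemma glue_distxx t : glue_dist t t = 0.
Proof. by case: t => i a; rewrite glue_distE mdistxx. Qed.

Lemma glue_dist_sym s t : glue_dist s t = glue_dist t s.
Proof.
case: s t => [i a] [j b]; have [ij|ij] := eqVneq i j.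
  by subst j; rewrite !glue_distE metric_sym.
by rewrite !glue_distN// 1?infsumC// eq_sym.
Qed.

Lemma glue_dist_triangle t s u : glue_dist s u <= glue_dist s t + glue_dist t u.
Proof.
case: s t u => [i a] [j b] [k c].
have [ik|ik] := eqVneq i k.
  subst k; rewrite glue_distE; have [ij|ij] := eqVneq i j.
    by subst j; rewrite !glue_distE metric_triangle.
  by rewrite !glue_distN//= 1?eq_sym//; exact: mdist_infsum.
have [ij|ij] := eqVneq i j.
  by subst j; rewrite glue_distE !glue_distN//; exact: infsum_mdist.
have [jk|jk] := eqVneq j k.
  subst k; rewrite glue_distE !glue_distN// infsumC addrC metric_sym.
  by rewrite (infsumC (p (existT _ i a))); exact: infsum_mdist.
by rewrite !glue_distN//; exact: infsum_triangle.
Qed.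

Definition glue_pd (i0 : option nat) : pseudodist R :=
  @Pseudodist R T (existT _ i0 (rmbc_root (Y i0))) glue_dist glue_distxx glue_dist_sym
    glue_dist_triangle.

End glue.

Section glue_seq.
Context {R : realType} (X_ : nat -> rmbc R) (X : rmbc R).
Variable delta_ : forall n, X_ n -> X -> R.
Hypothesis rdelta_ : forall n, rooted_coupling (@delta_ n).

Let Y (i : option nat) : rmbc R := if i is Some n then X_ n else X.
Let delta (i : option nat) : Y i -> X -> R :=
  match i return Y i -> X -> R with
  | Some n => @delta_ n
  | None => fun x y => mdist x y
  end.
Arguments delta : clear implicits.

Let rdelta i : rooted_coupling (delta i).
Proof.
by case: i => [n|]; [exact: rdelta_|exact: mdist_rooted].
Qed.

Let cdelta i : coupling (delta i). Proof. exact: (rdelta i).1. Qed.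

Definition glued : pmetricType R := quot (glue_pd cdelta None).

Let iota i (a : Y i) : glued := quot_pi (existT _ i a : pd_sort (glue_pd cdelta None)).

Definition glue_seq n (a : X_ n) : glued := @iota (Some n) a.
Definition glue_lim (x : X) : glued := @iota None x.

Let iota_isometric i : isometric (@iota i).
Proof. by move=> a b; rewrite /iota quot_mdist /= glue_distE. Qed.

Lemma glue_seq_isometric n : isometric (@glue_seq n).
Proof. exact: (@iota_isometric (Some n)). Qed.

Lemma glue_lim_isometric : isometric glue_lim.
Proof. exact: (@iota_isometric None). Qed.

Lemma glue_seq_lim n (a : X_ n) x : mdist (glue_seq a) (glue_lim x) = delta_ a x.
Proof.
rewrite /glue_seq /glue_lim /iota quot_mdist /= glue_distN//=.
have [_ h2 _ _] := (rdelta_ n).1.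
have d0 y : 0 <= delta_ a y by apply: coupling_ge0; exact: (rdelta_ n).1.
apply/eqP; rewrite eq_le; apply/andP; split; last first.
  by apply: infsum_ge => y /=; rewrite (metric_sym x y).
have := @infsum_le _ _ (delta_ a) (mdist x) x d0 (@mdist_ge0 _ _ x).
by rewrite mdistxx addr0.
Qed.

Lemma glue_seq_root n : glue_seq (rmbc_root (X_ n)) = glue_lim (rmbc_root X).
Proof. by apply: mdist_positivity; rewrite glue_seq_lim (rdelta_ n).2. Qed.

Lemma glued_cover (z : glued) :
  (exists x, z = glue_lim x) \/ exists n (a : X_ n), z = glue_seq a.
Proof.
have [[[n|] a] ->] := quot_pi_surj z; last by left; exists a.
by right; exists n, a.
Qed.

Let rho := glue_lim (rmbc_root X).

Let mdist_seq n (a : X_ n) : mdist rho (glue_seq a) = mdist (rmbc_root (X_ n)) a.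
Proof. by rewrite /rho -(glue_seq_root n) glue_seq_isometric. Qed.

Let mdist_lim (x : X) : mdist rho (glue_lim x) = mdist (rmbc_root X) x.
Proof. by rewrite /rho glue_lim_isometric. Qed.

Hypothesis wdelta : forall e : R, 0 < e ->
  \forall n \near \oo, coupling_within e (@delta_ n).

(** Within a disc, all but finitely many pieces are close to [X], whence
    compactness is inherited from [X] and finitely many pieces. *)
Lemma glued_boundedly_compact : boundedly_compact glued.
Proof.
suff cD r : compact (disc rho r).
  move=> A cA [z [r Ar]]; apply: (subclosed_compact cA (cD (mdist rho z + r))).
  by move=> x /Ar /= zx; rewrite /disc /= (le_trans (metric_triangle rho z x))// lerD2l.
rewrite compact_ultra => F UF FD; have FF : ProperFilter F by exact: ultra_proper.
suff [K cK FK] : exists2 K : set glued, compact K &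
    forall e : R, 0 < e -> F (thicken K e).
  have [p Kp Fp] := ultra_thicken_cvg UF cK FK.
  exists p; split=> //; apply: (@disc_closed _ _ rho r) => B /Fp FB.
  exact: filter_ex (filterI FD FB).
have compact_piece n s : compact (@glue_seq n @` disc (rmbc_root (X_ n)) s).
  apply: continuous_compact; last exact/disc_compact/rmbc_bc.
  apply: continuous_subspaceT; apply: isometric_continuous.
  exact: glue_seq_isometric.
have thickenS (K : set glued) (e : R) : 0 < e -> F K -> F (thicken K e).
  by move=> e0; apply: filterS => x Kx; exists x => //; rewrite mdistxx.
have [[n Fn]|nF] := pselect (exists n, F (@glue_seq n @` disc (rmbc_root (X_ n)) r)).
  by eexists => [|e e0]; [exact: compact_piece|exact: thickenS Fn].
exists (glue_lim @` disc (rmbc_root X) (r + 1)).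
  apply: continuous_compact; last exact/disc_compact/rmbc_bc.
  apply: continuous_subspaceT; apply: isometric_continuous.
  exact: glue_lim_isometric.
move=> e e0.
(* the disc of radius [e'^-1] contains the disc of radius [r] *)
pose e' := Num.min (Num.min e 1) (`|r| + 1)^-1.
have r10 : 0 < `|r| + 1 by rewrite ltr_wpDl.
have e'0 : 0 < e' by rewrite !lt_min e0 ltr01 invr_gt0.
have e'r : r <= e'^-1.
  rewrite (@le_trans _ _ (`|r| + 1))//; first by rewrite (le_trans (ler_norm r))// lerDl.
  by rewrite -[leLHS]invrK lef_pV2 ?posrE ?invr_gt0// ge_min lexx orbT.
have e'e : e' <= e by rewrite !ge_min lexx.
have e'1 : e' <= 1 by rewrite !ge_min lexx orbT.
have [N _ hN] := wdelta e'0.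
have Fpieces : F [set z | forall n : 'I_N,
    (~` (@glue_seq n @` disc (rmbc_root (X_ n)) r)) z].
  apply: filter_forall => n.
  have [Fn|//] := in_ultra_setVsetC (@glue_seq n @` disc (rmbc_root (X_ n)) r) UF.
  by exfalso; apply: nF; exists n.
apply: filterS2 FD Fpieces => z; rewrite /disc /= => zr zpieces.
have [[x zx]|[n [a za]]] := glued_cover z; subst z.
  exists (glue_lim x); last by rewrite mdistxx.
  by exists x => //; rewrite /disc /= -mdist_lim; lra.
have [nN|Nn] := ltnP n N.
  exfalso; apply: (zpieces (Ordinal nN)); exists a => //.
  by rewrite /disc /= -mdist_seq.
have [rd h1 _ _] := hN n Nn.
have [|x ax] := h1 a; first by rewrite -mdist_seq; lra.
exists (glue_lim x); last by rewrite metric_sym glue_seq_lim; lra.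
exists x => //; rewrite /disc /=.
by have := rooted_coupling_dist a x rd; rewrite -mdist_seq; lra.
Qed.

Let disc_scale (r e : R) : 0 < e -> exists e', [/\ 0 < e', e' <= e & r <= e'^-1].
Proof.
move=> e0; have r10 : 0 < `|r| + 1 by rewrite ltr_wpDl.
exists (Num.min e (`|r| + 1)^-1); split; first by rewrite lt_min e0 invr_gt0.
  by rewrite ge_min lexx.
rewrite (@le_trans _ _ (`|r| + 1))//; first by rewrite (le_trans (ler_norm r))// lerDl.
rewrite -[leLHS]invrK lef_pV2 ?posrE ?invr_gt0//; first by rewrite ge_min lexx orbT.
by rewrite lt_min e0 invr_gt0.
Qed.

(** Closeness is only available within discs, and a compact set missed by the
    limit lies in a disc, at positive distance from the limit there. *)
Lemma glued_fell_cvg :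
  (fun n => range (@glue_seq n) : fell glued) @ \oo --> (range glue_lim : fell glued).
Proof.
apply: fell_cvg => V [[K cK ->]|[U oU ->]] /=.
  move=> limK; have [r Kr] := compact_sub_disc rho cK.
  have cL : compact (glue_lim @` disc (rmbc_root X) (r + 1)).
    apply: continuous_compact; last exact/disc_compact/rmbc_bc.
    apply: continuous_subspaceT; apply: isometric_continuous.
    exact: glue_lim_isometric.
  have [] := compact_thicken cK (closed_openC (compact_closed (@metric_hausdorff _ _) cL)).
    move=> z Kz [x _ xz].
    have : (range glue_lim `&` K) z by split=> //; exists x.
    by rewrite limK.
  move=> e e0 KeL.
  have e10 : 0 < Num.min e 1 by rewrite lt_min e0 ltr01.
  have [e' [e'0 e'e re']] := disc_scale r e10.
  have e'1 : e' <= 1 by rewrite (le_trans e'e)// ge_min lexx orbT.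
  have {}e'e : e' <= e by rewrite (le_trans e'e)// ge_min lexx.
  near=> n; rewrite /= -subset0 => _ [[a _ <-] Ka].
  have [rd h1 _ _] : coupling_within e' (@delta_ n) by near: n; exact: wdelta.
  have ar : mdist (rmbc_root (X_ n)) a <= r by rewrite -mdist_seq; exact: Kr.
  have [|x ax] := h1 a; first by lra.
  apply: (KeL (glue_lim x)).
    by exists (glue_seq a) => //; rewrite glue_seq_lim; lra.
  exists x => //; rewrite /disc /=.
  by have := rooted_coupling_dist a x rd; lra.
move=> [_ [[x _ <-] Ux]].
have /metricType_numDomainType.nbhs_mdistP [d /= d0 hd] : nbhs (glue_lim x) U.
  by apply: open_nbhs_nbhs.
have [e' [e'0 e'd re']] := disc_scale (mdist (rmbc_root X) x) d0.
near=> n.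
have [_ _ h2 _] : coupling_within e' (@delta_ n) by near: n; exact: wdelta.
have [a ax] := h2 x re'.
exists (glue_seq a); split; first by exists a.
by apply: hd; rewrite /= metric_sym glue_seq_lim; lra.
Unshelve. all: by end_near. Qed.

Lemma glued_vague_cvg :
  vague_cvg (fun n => image_meas (@glue_seq n)) (image_meas glue_lim).
Proof.
have bG := glued_boundedly_compact.
apply/vague_cvgP => //; [exact: glue_seq_isometric|exact: glue_lim_isometric|].
apply: vague_intg_lipschitz => //; [exact: glue_seq_isometric|exact: glue_lim_isometric|].
move=> G lG G01 [z [r sG]].
have {}sG x : G x != 0 -> mdist rho x <= mdist rho z + r.
  by move=> /sG h; rewrite (le_trans (metric_triangle rho z x))// lerD2l.
apply/cvgrPdist_le => e e0.
have [e' [e'0 e'e re']] := disc_scale (mdist rho z + r) e0.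
near=> n.
have [_ _ _ h3] : coupling_within e' (@delta_ n) by near: n; exact: wdelta.
rewrite distrC (le_trans _ e'e)//; apply: h3 => [||a x].
- split=> [a|a b|a /=]; [exact: G01| |].
    exact: (isometric_lipschitz1 (@glue_seq_isometric n) lG).
  by move=> /sG; rewrite mdist_seq; lra.
- split=> [a|a b|a /=]; [exact: G01| |].
    exact: (isometric_lipschitz1 glue_lim_isometric lG).
  by move=> /sG; rewrite mdist_lim; lra.
- by rewrite -glue_seq_lim; exact: lG.
Unshelve. all: by end_near. Qed.

Lemma glued_embedding_cvg : rooted_embedding_cvg X_ X.
Proof.
exists glued, rho, glue_seq, glue_lim; split.
- exact: glued_boundedly_compact.
- by move=> n; split; [exact: glue_seq_isometric|exact: glue_seq_root].
- by split; first exact: glue_lim_isometric.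
- exact: glued_fell_cvg.
- exact: glued_vague_cvg.
Qed.

End glue_seq.

(** * Closeness and embeddings in a common space *)

Section close_embedding.
Context {R : realType}.
Implicit Types X Y : rmbc R.

Definition ghv_close_cvg (X_ : nat -> rmbc R) X :=
  forall e : R, 0 < e -> \forall n \near \oo, ghv_close e (X_ n) X.

(** A coupling good at some scale is good at all coarser ones, so the finest
    available scale down to [m.+1%:R^-1] is used. If there is none, gluing at
    the roots still provides a rooted coupling. *)
Lemma best_coupling (m : nat) X Y : exists delta, @rooted_coupling R X Y delta /\
  forall k, (k <= m)%N -> ghv_close k.+1%:R^-1 X Y -> coupling_within k.+1%:R^-1 delta.
Proof.
elim: m => [|m [delta [rd hd]]].
  have [[delta hd]|nc] := pselect (ghv_close 1%:R^-1 X Y).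
    exists delta; split; first by case: hd.
    by move=> k; rewrite leqn0 => /eqP -> _.
  exists (@wedge_coupling R X Y); split; first exact: wedge_rooted.
  by move=> k; rewrite leqn0 => /eqP ->.
have [[delta' hd']|nc] := pselect (ghv_close m.+2%:R^-1 X Y).
  exists delta'; split; first by case: hd'.
  move=> k km _; apply: coupling_within_le hd' => //.
  by rewrite lef_pV2 ?posrE// ler_nat.
exists delta; split=> // k; rewrite leq_eqVlt => /orP[/eqP ->//|]; exact: hd.
Qed.

(** Couplings of ever finer scales are chosen along the sequence, and all
    spaces are glued along [X]. *)
Lemma ghv_close_rooted_embedding (X_ : nat -> rmbc R) X :
  ghv_close_cvg X_ X -> rooted_embedding_cvg X_ X.
Proof.
move=> cX; pose delta_ n := projT1 (cid (best_coupling n (X_ n) X)).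
have hdelta n : _ := projT2 (cid (best_coupling n (X_ n) X)).
apply: (@glued_embedding_cvg _ _ _ delta_ (fun n => (hdelta n).1)) => e e0.
pose k := Num.trunc e^-1.
have k0 : 0 < k.+1%:R^-1 :> R by rewrite invr_gt0.
have ke : k.+1%:R^-1 <= e.
  by rewrite -[leRHS]invrK lef_pV2 ?posrE ?invr_gt0// ltW// truncnS_gt.
near=> n; apply: (coupling_within_le k0 ke); apply: (hdelta n).2.
  by near: n; exact: nbhs_infty_ge.
by near: n; exact: cX.
Unshelve. all: by end_near. Qed.

(** A coupling that does not match the roots is rooted by adding the distance
    of the roots and allowing a detour through the glued roots. *)
Definition root_coupling X Y (delta : X -> Y -> R) (x : X) (y : Y) :=
  Num.min (wedge_coupling x y) (delta x y + delta (rmbc_root X) (rmbc_root Y)).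

Lemma root_coupling_rooted X Y (delta : X -> Y -> R) :
  coupling delta -> rooted_coupling (root_coupling delta).
Proof.
move=> cd; have [d1 d2 d3 d4] := cd; have [[w1 w2 w3 w4] w0] := wedge_rooted X Y.
have e0 : 0 <= delta (rmbc_root X) (rmbc_root Y) by exact: coupling_ge0.
set e := delta (rmbc_root X) (rmbc_root Y) in e0 *.
have lo x y : delta x y <= wedge_coupling x y + e.
  have := d1 x (rmbc_root X) y; have := d2 (rmbc_root X) y (rmbc_root Y).
  by rewrite /wedge_coupling -/e; lra.
have d0 x y : 0 <= delta x y by exact: coupling_ge0.
rewrite /root_coupling -/e; split; last first.
  by rewrite w0; apply/min_idPl; rewrite addr_ge0.
split=> [x x' y|x y y'|x x' y|x y y'].
- have := d1 x x' y; have := w1 x x' y.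
  by case: (leP (wedge_coupling x y) (delta x y + e)) => ?;
    case: (leP (wedge_coupling x' y) (delta x' y + e)) => ?; lra.
- have := d2 x y y'; have := w2 x y y'.
  by case: (leP (wedge_coupling x y) (delta x y + e)) => ?;
    case: (leP (wedge_coupling x y') (delta x y' + e)) => ?; lra.
- have := d3 x x' y; have := w3 x x' y; have := lo x y; have := lo x' y.
  by case: (leP (wedge_coupling x y) (delta x y + e)) => ?;
    case: (leP (wedge_coupling x' y) (delta x' y + e)) => ?; lra.
- have := d4 x y y'; have := w4 x y y'; have := lo x y; have := lo x y'.
  by case: (leP (wedge_coupling x y) (delta x y + e)) => ?;
    case: (leP (wedge_coupling x y') (delta x y' + e)) => ?; lra.
Qed.

Lemma isometric_coupling X Y (M : metricType R) (f : X -> M) (g : Y -> M) :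
  isometric f -> isometric g -> coupling (fun x y => mdist (f x) (g y)).
Proof.
move=> hf hg; split=> [x x' y|x y y'|x x' y|x y y'].
- by rewrite -hf; exact: metric_triangle.
- by rewrite -hg; exact: metric_triangle.
- by rewrite -hf (metric_sym (f x') (g y)); exact: metric_triangle.
- by rewrite -hg (metric_sym (f x) (g y)); exact: metric_triangle.
Qed.

(** The coupling is the ambient distance, rooted. A pair of test functions is
    then the trace of one Lipschitz function on the ambient space, up to an error
    controlled by the distance of the roots and the Hausdorff distance; vague
    convergence is uniform over such functions. *)
Lemma embedding_ghv_close (X_ : nat -> rmbc R) X :
  embedding_cvg X_ X -> ghv_close_cvg X_ X.
Proof.
move=> [M [f_ [f [bM [isof_ isof] cF crho /vague_cvgP cV]]]] e e0.
have {}cV : vague_intg f_ f by exact: cV.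
pose rho_ n := f_ n (rmbc_root (X_ n)); pose rho := f (rmbc_root X).
have rn (n : nat) (a : X_ n) : mdist rho (f_ n a) <=
    mdist (rmbc_root (X_ n)) a + mdist rho (rho_ n).
  by rewrite -(isof_ n) addrC; exact: metric_triangle.
(* Beyond [e^-1], there must be room for the displacement of the roots and for
   the growth of supports under McShane extension. *)
pose r := e^-1 + 3.
pose psi := plateau rho r.
have tpsi : tame psi by exact: tame_plateau.
have cpsi : continuous psi by exact/lipschitz1_continuous/plateau_lipschitz1.
have spsi : bounded_support psi by exists rho, (r + 1) => x; exact: plateau_neq0.
pose B := intg (psi \o f) + 1.
have B0 : 0 < B.
  by rewrite ltr_wpDl// intg_ge0// => x; have /andP[] := plateau01 rho r (f x).
pose s := Num.min (Num.min 1 (e / 4)) (e / (8 * B)).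
have s0 : 0 < s by rewrite !lt_min ltr01 !divr_gt0// mulr_gt0.
have s1 : s <= 1 by rewrite !ge_min lexx.
have se : s <= e / 4 by rewrite !ge_min lexx orbT.
have sB : s * B <= e / 8.
  rewrite (@le_trans _ _ (e / (8 * B) * B)) ?ler_pM2r//; first by rewrite ge_min lexx orbT.
  by rewrite invfM -!mulrA mulVf ?gt_eqF// mulr1.
pose Fam := [set F : M -> R | [/\ lipschitz1 F, forall x, 0 <= F x <= 1 &
  forall x, F x != 0 -> mdist rho x <= r]].
have e20 : 0 < e / 2 by rewrite divr_gt0.
have hFam : \forall n \near \oo, forall F, Fam F ->
    `|intg (F \o f_ n) - intg (F \o f)| <= e / 2.
  apply: (@vague_uniform _ X_ X M f_ f bM isof_ isof cV rho r Fam) => //.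
  - by move=> F [_ F01 _] x; have /andP[? ?] := F01 x; rewrite ger0_norm.
  - by move=> F [].
  - move=> eta eta0; exists eta => // F [lF _ _] x y; exact: le_lt_trans.
have psiB : intg (psi \o f) < B by rewrite ltrDl.
have hpsi := vague_intg_le cV cpsi spsi psiB.
have sub1 := @fell_cvg_thicken_sub _ M _ _ rho r s bM cF s0.
have sub2 := @fell_cvg_sub_thicken _ M _ _ rho r s bM cF s0.
have hrho : \forall n \near \oo, mdist rho (rho_ n) < s.
  by move: crho => /metricType_numDomainType.cvgrPdist_lt; exact.
near=> n.
have rhon : mdist rho (rho_ n) < s by near: n.
have near1 (a : X_ n) : mdist (rmbc_root (X_ n)) a <= r - s ->
    exists x, mdist (f_ n a) (f x) < s.
  have h : range (f_ n) `&` disc rho r `<=` thicken (range f) s by near: n.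
  move=> ar; have [|_ [x _ <-] ax] := h (f_ n a).
    by split; [exists a|rewrite /disc /=; have := rn n a; lra].
  by exists x => //; rewrite metric_sym.
pose d := fun (a : X_ n) (x : X) => mdist (f_ n a) (f x).
have cd : coupling d by exact: isometric_coupling.
have dr : d (rmbc_root (X_ n)) (rmbc_root X) < s by rewrite /d metric_sym.
have rd_le a x : root_coupling d a x <= d a x + s.
  by rewrite /root_coupling ge_min; apply/orP; right; rewrite lerD2l ltW.
have ve : 0 < e^-1 by rewrite invr_gt0.
exists (root_coupling d); split; first exact: root_coupling_rooted.
- move=> a ae; have [|x ax] := near1 a; first by rewrite /r; lra.
  by exists x; rewrite (le_lt_trans (rd_le a x))// /d; lra.
- move=> x xe; have h : range f `&` disc rho r `<=` thicken (range (f_ n)) s by near: n.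
  have [|_ [a _ <-] ax] := h (f x).
    by split; [exists x|rewrite /disc /= isof /r; lra].
  by exists a; rewrite (le_lt_trans (rd_le a x))// /d; lra.
move=> phi gam tphi tgam pg.
have [phi01 lphi sphi] := tphi; have [gam01 lgam sgam] := tgam.
have v1 x : gam x <= 1 by have /andP[] := gam01 x.
have D0 x (z : M) : 0 <= mdist (f x) z by exact: mdist_ge0.
pose G := mcshane gam (fun x (z : M) => mdist (f x) z).
have lG : lipschitz1 G by apply: mcshane_lipschitz1 => // x z z'; exact: metric_triangle.
have sG z : G z != 0 -> mdist rho z <= e^-1 + 1.
  move=> /(mcshane_support D0 v1)[x xz].
  have gx : gam x != 0 by rewrite gt_eqF// (le_lt_trans _ xz).
  have := metric_triangle rho (f x) z; rewrite isof; have := sgam x gx.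
  by have := v1 x; lra.
have GF : Fam G.
  split=> //; first by move=> z; rewrite mcshane_ge0// mcshane_le1.
  by move=> z /sG; rewrite /r; lra.
have Gf : gam = G \o f.
  apply/funext => x; apply/eqP; rewrite eq_le; apply/andP; split.
    by have := @mcshane_ge _ _ _ gam _ D0 v1 x (f x); rewrite mdistxx subr0.
  apply: mcshane_le => [|x']; first by have /andP[] := gam01 x.
  by have := lgam x' x; rewrite isof ler_norml => /andP[]; lra.
have tG : tame G.
  apply: (@tame_continuous _ _ _ 1 rho r); first exact: lipschitz1_continuous.
    by move=> z; rewrite ger0_norm ?mcshane_ge0// mcshane_le1.
  by move=> z /sG; rewrite /r; lra.
have phiG a : `|phi a - G (f_ n a)| <= 4 * s * psi (f_ n a).
  have [ar|ar] := leP (mdist (rmbc_root (X_ n)) a) (r - s).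
    have -> : psi (f_ n a) = 1 by apply: plateau1; have := rn n a; lra.
    have [x ax] := near1 a ar.
    have := le_trans (pg a x) (rd_le a x); have := lG (f_ n a) (f x).
    have -> : G (f x) = gam x by rewrite Gf.
    by rewrite /d !ler_norml => /andP[? ?] /andP[? ?]; apply/andP; split; lra.
  have -> : phi a = 0.
    by apply: contraTeq ar => /sphi; rewrite -leNgt /r; lra.
  have -> : G (f_ n a) = 0.
    apply: contraTeq ar => /sG h; rewrite -leNgt.
    have : mdist (rmbc_root (X_ n)) a <= mdist rho (rho_ n) + mdist rho (f_ n a).
      by rewrite -(isof_ n) (metric_sym rho (rho_ n)); exact: metric_triangle.
    by rewrite /r; lra.
  rewrite subrr normr0 !mulr_ge0 ?(ltW s0)//.
  by have /andP[] := plateau01 rho r (f_ n a).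
have h1 : `|intg phi - intg (G \o f_ n)| <= 4 * s * intg (psi \o f_ n).
  rewrite -intgZ; last exact: tame_comp.
  apply: dist_intg => //; first exact: test_tame tphi.
  - exact: tame_comp.
  - by apply: tameZ; exact: tame_comp.
have h2 : `|intg (G \o f_ n) - intg (G \o f)| <= e / 2.
  by move: G GF {lG sG Gf tG phiG h1}; near: n.
have h3 : intg (psi \o f_ n) < B by near: n.
have h4 : 4 * s * intg (psi \o f_ n) <= e / 2.
  rewrite (@le_trans _ _ (4 * s * B)) ?ler_pM2l ?mulr_gt0//; first exact: ltW.
  by rewrite -mulrA; lra.
rewrite Gf.
have -> : intg phi - intg (G \o f) =
  (intg phi - intg (G \o f_ n)) + (intg (G \o f_ n) - intg (G \o f)) by lra.
by rewrite (le_trans (ler_normD _ _))//; lra.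
Unshelve. all: by end_near. Qed.

End close_embedding.

(** * Exponentially weighted averages over radii *)

Section exp_average.
Context {R : realType}.
Local Open Scope ereal_scope.
Notation mu := (@lebesgue_measure R).
Import HBNNSimple.

Lemma cvge0P (u : nat -> \bar R) : (forall n, 0 <= u n) ->
  u @ \oo --> (0 : \bar R) <->
  forall e : R, (0 < e)%R -> \forall n \near \oo, u n <= e%:E.
Proof.
move=> u0; split=> [/fine_cvgP[uf /cvgrPdist_lt cu] e e0|h].
  have := cu e e0; apply: filterS2 uf => n uf /=.
  rewrite sub0r normrN => ue; rewrite -(fineK uf) lee_fin.
  by rewrite (le_trans (ler_norm _))// ltW.
apply/fine_cvgP; split.
  have := h 1%R ltr01; apply: filterS => n u1.
  by rewrite ge0_fin_numE// (le_lt_trans u1)// ltry.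
apply/cvgrPdist_le => e e0; have := h e e0; apply: filterS => n ue /=.
have uf : u n \is a fin_num by rewrite ge0_fin_numE// (le_lt_trans ue)// ltry.
by rewrite sub0r normrN ger0_norm ?fine_ge0// -lee_fin fineK.
Qed.

Lemma ge0_integral_mono (f g : R -> \bar R) (D : set R) :
  (forall x, D x -> 0 <= f x) -> (forall x, D x -> f x <= g x) ->
  \int[mu]_(x in D) f x <= \int[mu]_(x in D) g x.
Proof.
move=> f0 fg; rewrite !ge0_integralE//; last first.
  by move=> x Dx; exact: le_trans (f0 _ Dx) (fg _ Dx).
apply: ereal_sup_le => _ [h hf <-]; exists h => // x.
apply: le_trans (hf x) _; rewrite !patchE; case: ifPn => //.
by rewrite inE; exact: fg.
Qed.

(** The integral of a nonnegative function is a supremum of integrals of simple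
    functions below it. Dominated convergence is applied to such functions rather
    than to the integrands, whose measurability in the radius is unclear. *)
Lemma exp_average_cvg0 (D_ : nat -> R -> \bar R) (N : set R) : countable N ->
  (forall n r, 0 <= D_ n r) ->
  (forall r : R, (0 <= r)%R -> ~ N r -> D_ n r @[n --> \oo] --> (0 : \bar R)) ->
  exp_average (D_ n) @[n --> \oo] --> (0 : \bar R).
Proof.
move=> cN D0 cD.
pose g n r := (expR (- r))%:E * mine 1 (D_ n r).
have min0 n r : 0 <= mine 1 (D_ n r) by rewrite le_min D0 lee01.
have g0 n r : 0 <= g n r by rewrite mule_ge0// lee_fin expR_ge0.
have gexp n r : `[0%R, +oo[%classic r -> g n r <= (exponential_pdf 1 r)%:E.
  rewrite /= in_itv /= andbT => r0; rewrite exponential_pdfE// mul1r mulN1r /g.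
  by rewrite -[leRHS]mule1 lee_wpmul2l ?lee_fin ?expR_ge0// ge_min lexx.
have I0 n : 0 <= exp_average (D_ n) by apply: integral_ge0 => r _; exact: g0.
have I1 n : exp_average (D_ n) <= 1.
  rewrite -(@integral_exponential_pdf R 1)//.
  apply: (@le_trans _ _ (\int[mu]_(r in `[0%R, +oo[) (exponential_pdf 1 r)%:E)).
    by apply: ge0_integral_mono => r hr; [exact: g0|exact: gexp].
  apply: ge0_subset_integral => //.
  - by apply/measurable_EFinP; apply: measurable_exponential_pdf.
  - by move=> x _; rewrite lee_fin; apply: exponential_pdf_ge0; exact: ler01.
have If n : exp_average (D_ n) \is a fin_num.
  by rewrite ge0_fin_numE// (le_lt_trans (I1 n))// ltry.
have exh n : exists h : {nnsfun (measurableTypeR R) >-> R},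
    (forall r, (h r)%:E <= (g n \_ `[0%R, +oo[) r) /\
    exp_average (D_ n) - (n.+1%:R^-1)%:E <= sintegral mu h.
  have := If n; rewrite /exp_average ge0_integralE; last by move=> r _; exact: g0.
  have n0 : (0 < n.+1%:R^-1 :> R)%R by rewrite invr_gt0.
  move=> /(ub_ereal_sup_adherent n0)[_ [h hg <-] hI].
  by exists h; split=> //; exact: ltW.
have [h_ hh] := choice exh.
have hexp n r : (h_ n r)%:E <= (exponential_pdf 1 r)%:E.
  apply: le_trans ((hh n).1 r) _; rewrite patchE; case: ifPn => [|_].
    by rewrite inE => /gexp.
  by rewrite lee_fin; apply: exponential_pdf_ge0; exact: ler01.
have h0 n r : 0 <= (h_ n r)%:E by rewrite lee_fin; exact: fun_ge0.
have h_cvg : {ae mu, forall r, setT r -> (h_ n r)%:E @[n --> \oo] --> (cst 0 r : \bar R)}.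
  exists N; split; [|exact: countable_lebesgue_measure0|].
    by apply: countable_measurable => // t; exact: measurable_set1.
  move=> r /= nr; apply: contrapT => Nr; apply: nr => _.
  have [r0|r0] := leP 0%R r.
    apply: (@squeeze_cvge _ _ _ _ (cst 0) _ (D_ ^~ r)); last exact: cD.
      apply: nearW => n; rewrite /= h0 /=.
      apply: le_trans ((hh n).1 r) _; rewrite patchE mem_set; last first.
        by rewrite /= in_itv /= r0.
      rewrite /g -[leRHS]mul1e lee_pmul//.
      - by rewrite lee_fin -expR0 ler_expR oppr_le0.
      - by rewrite ge_min lexx orbT.
    exact: cvg_cst.
  apply: cvg_near_cst; apply: nearW => n; apply/eqP; rewrite eq_le h0 andbT.
  apply: le_trans ((hh n).1 r) _; rewrite patchE memNset//.
  by rewrite /= in_itv /= andbT; apply/negP; rewrite -ltNge.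
have h_dom : {ae mu, forall r n, setT r -> `|(h_ n r)%:E| <= (EFin \o exponential_pdf 1) r}.
  by apply: aeW => r n _; rewrite gee0_abs.
have mh n : measurable_fun [set: measurableTypeR R] (fun r => (h_ n r)%:E).
  by apply/measurable_EFinP; exact: measurable_funP.
have [_ _] := @dominated_convergence _ _ _ mu setT measurableT
  (fun n r => (h_ n r)%:E) (cst 0) (EFin \o exponential_pdf 1)
  mh (measurable_cst _) h_cvg (integrable_exponential_pdf ltr01) h_dom.
rewrite integral0 => /= hI.
have {}hI : (fun n => \int[mu]_x (h_ n x)%:E + (n.+1%:R^-1)%:E) @ \oo --> (0 : \bar R).
  rewrite -[X in _ --> X]adde0; apply: cvgeD => //.
  by apply: cvg_EFin; [exact: nearW|exact: cvg_harmonic].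
apply: (@squeeze_cvge _ _ _ _ (cst 0)) hI; last exact: cvg_cst.
apply: nearW => n; rewrite /= I0 /= integralT_nnsfun -leeBlDr//.
exact: (hh n).2.
Qed.

(** Otherwise the integral over [[a, a + 1]] alone would be too large. *)
Lemma exp_average_lt (D : R -> \bar R) (a c : R) : (0 <= a)%R -> (0 < c <= 1)%R ->
  (forall r, 0 <= D r) -> exp_average D < (expR (- (a + 1)) * c)%:E ->
  exists2 r : R, (a <= r)%R & D r < c%:E.
Proof.
move=> a0 /andP[c0 c1] D0; apply: contraPP => /forall2NP h; apply/negP; rewrite -leNgt.
have {}h r : (a <= r)%R -> c%:E <= D r.
  by move=> ar; have [//|/negP] := h r; rewrite -leNgt.
pose k := (expR (- (a + 1)) * c)%R.
have k0 : (0 <= k)%R by rewrite mulr_ge0 ?expR_ge0// ltW.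
have aa : (a + 1 - a = 1)%R by lra.
have I : \int[mu]_(r in `[a, (a + 1)%R]) (cst k%:E) r = k%:E.
  by rewrite integral_cst//= lebesgue_measure_itv/= lte_fin ltrDl ltr01 -EFinB aa mule1.
rewrite -I integral_mkcond [leRHS]integral_mkcond.
apply: ge0_integral_mono => r _; rewrite !patchE.
  by case: ifPn => // _; rewrite lee_fin.
case: ifPn => [|_]; last first.
  case: ifPn => // _; rewrite mule_ge0 ?lee_fin ?expR_ge0//.
  by rewrite le_min D0 lee01.
rewrite inE /= in_itv /= => /andP[ar ra].
rewrite mem_set; last by rewrite /= in_itv /= andbT (le_trans a0).
rewrite /k EFinM lee_pmul ?lee_fin ?expR_ge0 ?(ltW c0)//.
  by rewrite ler_expR lerN2.
by rewrite le_min lee_fin c1 h.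
Qed.

End exp_average.

(** * Exceptional radii *)

Section radii.
Context {R : realType}.

(** Distinct jumps contain distinct rationals. *)
Lemma jumps_countable (V : R -> R) : {homo V : x y / x <= y} ->
  countable [set r | exists2 eta : R, 0 < eta &
    forall s, 0 < s -> eta <= V (r + s) - V (r - s)].
Proof.
move=> ndV; set J := [set r | _].
have exq r : exists q : rat, J r ->
    (forall t, t < r -> V t <= ratr q) /\ (forall u, r < u -> ratr q < V u).
  have [[eta eta0 hr]|nJ] := pselect (J r); last by exists 0.
  pose A := [set V t | t in [set t | t < r]].
  have A0 : A !=set0 by exists (V (r - 1)), (r - 1) => //=; lra.
  have jump t u : t < r -> r < u -> V t <= V u - eta.
    move=> tr ru; pose s := Num.min (r - t) (u - r).
    have s0 : 0 < s by rewrite lt_min !subr_gt0 tr ru.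
    have st : s <= r - t by rewrite ge_min lexx.
    have su : s <= u - r by rewrite ge_min lexx orbT.
    have := hr s s0; have : V t <= V (r - s) by apply: ndV; lra.
    have : V (r + s) <= V u by apply: ndV; lra.
    by lra.
  have Aub u : r < u -> ubound A (V u - eta) by move=> ru _ [t /= tr <-]; exact: jump.
  have hA : has_ubound A by exists (V (r + 1) - eta); apply: Aub; lra.
  have sA u : r < u -> sup A <= V u - eta by move=> /Aub; exact: ge_sup.
  have [q] := @rat_in_itvoo _ (sup A) (sup A + eta) ltac:(by rewrite ltrDl).
  rewrite in_itv /= => /andP[q1 q2]; exists q => _; split=> [t tr|u /sA]; last by lra.
  by rewrite (le_trans _ (ltW q1))//; apply: ub_le_sup => //; exists t.
have [q hq] := choice exq.
have injq : {in J &, injective q}.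
  have lt r r' : J r -> J r' -> r < r' -> q r <> q r'.
    move=> Jr Jr' rr' qq; have [_ h1] := hq _ Jr; have [h2 _] := hq _ Jr'.
    have := h1 ((r + r') / 2) ltac:(lra); have := h2 ((r + r') / 2) ltac:(lra).
    by rewrite qq; lra.
  move=> r r' /set_mem Jr /set_mem Jr' qq; apply/eqP; rewrite eq_le.
  by rewrite !leNgt; apply/andP; split; apply/negP => /lt; [move=> /(_ Jr' Jr)|
    move=> /(_ Jr Jr')]; apply.
apply/countable_injP; exists (pickle \o q) => r r' rJ r'J /= /(pcan_inj pickleK).
exact: injq.
Qed.

(** The exceptional radii are the infima of the radii of points of [A] in the
    balls of countably many finite nets: if [r] is not one of them, a ball that
    meets [A] at a radius at most [r + e], for small [e], also meets [A] at a
    radius below [r]. *)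
Lemma hausdorff_radii (M : pmetricType R) (A : set M) (o : M) : boundedly_compact M ->
  exists2 N : set R, countable N & forall r, ~ N r -> forall eta : R, 0 < eta ->
    exists2 e : R, 0 < e & forall x, A x -> mdist o x <= r + e ->
      exists a, [/\ A a, mdist x a < eta & mdist o a <= r - e].
Proof.
move=> bM.
have sk (k : nat) : exists s : seq M, forall x, disc o k%:R x ->
    exists2 a, a \in s & mdist a x < k.+1%:R^-1.
  by apply: compact_net; [rewrite invr_gt0|exact: disc_compact].
have [s hs] := choice sk.
pose ball k i := A `&` [set x | mdist (nth o (s k) i) x < k.+1%:R^-1].
pose m (ki : nat * nat) := inf [set mdist o x | x in ball ki.1 ki.2].
exists (range m); first exact: sub_countable (card_image_le _ _) _.
move=> r Nr eta eta0.
have [k [kr keta]] : exists k : nat, r + 1 <= k%:R /\ 2 < eta * k.+1%:R.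
  exists (maxn (Num.trunc `|r + 1|).+1 (Num.trunc (2 / eta)).+1); split.
    rewrite (le_trans (ler_norm _))// (le_trans (ltW (truncnS_gt _)))//.
    by rewrite ler_nat leq_maxl.
  rewrite mulrC -ltr_pdivrMr// (lt_le_trans (truncnS_gt _))// ler_nat.
  by rewrite ltnW// ltnS leq_maxr.
have near_i (i : 'I_(size (s k))) : \forall e \near (0 : R)^'+, forall x, ball k i x ->
    mdist o x <= r + e -> exists2 a, ball k i a & mdist o a <= r - e.
  have [[a [ba ar]]|nb] := pselect (exists a, ball k i a /\ mdist o a < r).
    near=> e => x _ _; exists a => //.
    have : e < r - mdist o a by near: e; apply: nbhs_right_lt; rewrite subr_gt0.
    by lra.
  have rb x : ball k i x -> r <= mdist o x.
    by move=> bx; rewrite leNgt; apply/negP => xr; apply: nb; exists x.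
  have [b0|nb0] := pselect (ball k i !=set0); last first.
    by apply: nearW => e x bx; exfalso; apply: nb0; exists x.
  have hinf : has_lbound [set mdist o x | x in ball k i].
    by exists r => _ [x bx <-]; exact: rb.
  have rm : r < m (k, nat_of_ord i).
    rewrite lt_neqAle; apply/andP; split.
      by apply/eqP => rm; apply: Nr; exists (k, nat_of_ord i).
    apply: lb_le_inf; first by case: b0 => x bx; exists (mdist o x), x.
    by move=> _ [x bx <-]; exact: rb.
  near=> e => x bx xr; exfalso.
  have : e < m (k, nat_of_ord i) - r by near: e; apply: nbhs_right_lt; rewrite subr_gt0.
  have : m (k, nat_of_ord i) <= mdist o x by apply: ge_inf => //; exists x.
  by lra.
have ff : Filter (0 : R)^'+ by exact _.
have {}near_i := @filter_forall _ _ _ (0 : R)^'+ ff near_i.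
near (0 : R)^'+ => e.
have e0 : 0 < e by near: e; exact: nbhs_right_gt.
have e1 : e < 1 by near: e; exact: nbhs_right_lt.
have he : forall i : 'I_(size (s k)), forall x, ball k i x ->
    mdist o x <= r + e -> exists2 a, ball k i a & mdist o a <= r - e by near: e.
exists e => // x Ax xr; have [|b /(nthP o)[i si ib] bx] := hs k x.
  by rewrite /disc /=; lra.
have [||a [Aa /= ba] ar] := he (Ordinal si) x; [by split; rewrite //= ib|by []|].
exists a; split=> //; rewrite /= ib in ba.
have kk : 2 * k.+1%:R^-1 < eta by rewrite ltr_pdivrMr.
rewrite (le_lt_trans (metric_triangle x b a))//.
rewrite (metric_sym x b); move: bx ba kk; set c := k.+1%:R^-1 => *; lra.
Unshelve. all: by end_near. Qed.

End radii.

(** * The distance between rooted measured spaces *)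

Section distances.
Context {R : realType}.

Lemma hausdorff_dist_ge0 (Z : metricType R) (A B : set Z) :
  (0 <= hausdorff_dist A B)%E.
Proof. by apply: le_ereal_inf_tmp => _ [e [e0 _ _] <-]; rewrite lee_fin ltW. Qed.

Lemma hausdorff_dist_le (Z : metricType R) (A B : set Z) (e : R) : 0 < e ->
  A `<=` thicken B e -> B `<=` thicken A e -> (hausdorff_dist A B <= e%:E)%E.
Proof. by move=> e0 AB BA; apply: ereal_inf_lbound; exists e. Qed.

Lemma hausdorff_dist_lt (Z : metricType R) (A B : set Z) (e : R) :
  (hausdorff_dist A B < e%:E)%E -> A `<=` thicken B e /\ B `<=` thicken A e.
Proof.
move=> /ereal_inf_lt[_ [d [d0 AB BA] <-]]; rewrite lte_fin => de.
by split=> x; [move=> /AB|move=> /BA] => -[y By yx]; exists y => //; exact: lt_trans de.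
Qed.

Section BL.
Variables (kappa : R) (hkappa : 0 < kappa <= 1).

Let k0 : 0 < kappa. Proof. by case/andP: hkappa. Qed.

Lemma BL_norm_le1 (Z : pmetricType R) (F : Z -> R) : (BL_norm kappa F <= 1)%E ->
  (forall x, `|F x| <= 1) /\ (forall x y, `|F x - F y| <= mdist x y `^ kappa).
Proof.
rewrite /BL_norm; set A := ereal_sup _; set B := ereal_sup _ => AB1.
have FA x : ((`|F x|)%:E <= A)%E by apply: ereal_sup_ubound; exists x.
have A0 : (0 <= A)%E by apply: le_trans (FA point); rewrite lee_fin.
have A1 : (A <= 1)%E by apply: le_trans AB1; rewrite leeDl// le_max lexx.
have B1 : (B <= 1)%E.
  by apply: le_trans AB1; rewrite (@le_trans _ _ (maxe 0 B)%E)// ?le_max ?lexx ?orbT// leeDr.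
split=> [x|x y]; first by rewrite -lee_fin; exact: le_trans (FA x) A1.
have [->|xy] := eqVneq x y; first by rewrite subrr normr0 powR_ge0.
have dk : 0 < mdist x y `^ kappa by rewrite powR_gt0 ?mdist_gt0.
rewrite -[leRHS]mul1r -ler_pdivrMr// -lee_fin; apply: le_trans B1.
by apply: ereal_sup_ubound; exists (x, y).
Qed.

Lemma le_powR_kappa (t : R) : 0 <= t -> t <= 1 -> t <= t `^ kappa.
Proof.
case/andP: hkappa => _ k1; rewrite le_eqVlt => /orP[/eqP <- _|t0 t1].
  exact: powR_ge0.
by rewrite -[leLHS](powRr1 (ltW t0)) ger_powR// t0 t1.
Qed.

(** The constant splits the bound evenly between the two terms of the norm. For
    points at distance at most [1], Lipschitz is stronger than Hoelder as
    [kappa <= 1]; for others, the oscillation is at most [1]. *)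
Lemma lipschitz_BL_norm (Z : pmetricType R) (F : Z -> R) :
  lipschitz1 F -> (forall x, 0 <= F x <= 1) ->
  (BL_norm kappa (fun x => 2^-1 * F x)%R <= 1)%E.
Proof.
move=> lF F01; rewrite /BL_norm.
have -> : (1 = 2^-1%:E + 2^-1%:E :> \bar R)%E by rewrite -EFinD; congr EFin; lra.
apply: leeD.
  apply: ge_ereal_sup => _ [x _ <-]; rewrite lee_fin.
  by have := F01 x => /andP[? ?]; rewrite ger0_norm; lra.
rewrite ge_max lee_fin invr_ge0 ler0n /=.
apply: ge_ereal_sup => _ [[x y] /= xy <-]; rewrite lee_fin.
have d0 : 0 < mdist x y by rewrite mdist_gt0.
have dk : 0 < mdist x y `^ kappa by rewrite powR_gt0.
rewrite ler_pdivrMr// -mulrBr normrM ger0_norm ?invr_ge0// ler_pM2l ?invr_gt0//.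
have [d1|d1] := leP (mdist x y) 1.
  by rewrite (le_trans (lF x y))// le_powR_kappa// ltW.
have : 1 <= mdist x y `^ kappa.
  have E : 1 `^ kappa = 1 :> R by rewrite powR1.
  by rewrite -[leLHS]E ge0_ler_powR ?(ltW k0)// ?nnegrE ?ltW.
apply: le_trans; have := F01 x; have := F01 y => /andP[? ?] /andP[? ?].
by rewrite ler_norml; apply/andP; split; lra.
Qed.

Lemma powR_kappa_lt (e : R) : 0 < e -> exists2 d : R, 0 < d &
  forall t, 0 <= t -> t < d -> t `^ kappa < e.
Proof.
move=> e0; exists (e `^ kappa^-1); first exact: powR_gt0.
move=> t t0 td; have := gt0_ltr_powR k0 _ _ td.
by rewrite !nnegrE t0 powR_ge0 -powRrM mulVf ?gt_eqF// powRr1 ?ltW//; apply.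
Qed.

Lemma BL_dist_ge0 (Z : pmetricType R) (mu nu : set (borel Z) -> \bar R) :
  (0 <= BL_dist kappa mu nu)%E.
Proof.
apply: (@le_trans _ _ (`|\int[mu]_x (0 : R)%:E - \int[nu]_x (0 : R)%:E|)%E) => //.
apply: ereal_sup_ubound; exists (cst 0) => //=.
have -> : (1 = 1 + 0 :> \bar R)%E by rewrite adde0.
apply: leeD.
  by apply: ge_ereal_sup => _ [x _ <-]; rewrite lee_fin normr0.
rewrite ge_max lexx /=; apply: ge_ereal_sup => _ [p _ <-].
by rewrite lee_fin subrr normr0 mul0r.
Qed.

Lemma BL_continuous (Z : pmetricType R) (F : Z -> R) :
  (forall x y, `|F x - F y| <= mdist x y `^ kappa) -> continuous F.
Proof.
move=> hF; apply: continuous_mdistP => x e /powR_kappa_lt[d d0 hd].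
by exists d => // y xy; rewrite (le_lt_trans (hF x y))// hd// mdist_ge0.
Qed.

End BL.

(** ** From a common rooted space to small distance *)

Section rooted_embedding.
Variables (X_ : nat -> rmbc R) (X : rmbc R) (M : pmetricType R) (rho : M).
Variables (f_ : forall n, X_ n -> M) (f : X -> M).
Hypothesis bM : boundedly_compact M.
Hypothesis isof_ : forall n, isometric (@f_ n).
Hypothesis isof : isometric f.

(** At a regular radius, a point of [A] near the sphere is replaced by a nearby
    one strictly inside the disc, whose approximations remain in the disc. *)
Lemma hausdorff_dist_disc_cvg (A_ : nat -> set M) (A : set M) :
  (fun n => A_ n : fell M) @ \oo --> (A : fell M) ->
  exists2 N : set R, countable N & forall r, ~ N r ->
    hausdorff_dist (A_ n `&` disc rho r) (A `&` disc rho r) @[n --> \oo]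
      --> (0 : \bar R)%E.
Proof.
move=> cA; have [N cN hN] := hausdorff_radii A rho bM; exists N => // r Nr.
apply/cvge0P => [n|eta eta0]; first exact: hausdorff_dist_ge0.
have eta20 : 0 < eta / 2 by rewrite divr_gt0.
have [e e0 he] := hN r Nr _ eta20.
pose s := Num.min e (eta / 2).
have s0 : 0 < s by rewrite lt_min e0.
have se : s <= e by rewrite ge_min lexx.
have seta : s <= eta / 2 by rewrite ge_min lexx orbT.
have sub1 := @fell_cvg_thicken_sub _ M _ _ rho r s bM cA s0.
have sub2 := @fell_cvg_sub_thicken _ M _ _ rho r s bM cA s0.
apply: filterS2 sub1 sub2 => n sub1 sub2; apply: hausdorff_dist_le => //.
- move=> y /[dup] /sub1[x Ax xy] [_]; rewrite /disc /= => yr.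
  have [|a [Aa xa ar]] := he x Ax.
    by have := metric_triangle rho y x; rewrite (metric_sym y x); lra.
  exists a; first by split=> //; rewrite /disc /=; lra.
  by have := metric_triangle a x y; rewrite (metric_sym a x); lra.
- move=> x [Ax]; rewrite /disc /= => xr.
  have [|a [Aa xa ar]] := he x Ax; first by lra.
  have [|y Ay ya] := sub2 a; first by split=> //; rewrite /disc /=; lra.
  exists y; first split=> //.
    by rewrite /disc /=; have := metric_triangle rho a y; rewrite (metric_sym a y); lra.
  by have := metric_triangle y a x; rewrite (metric_sym a x); lra.
Qed.

Variables (kappa : R) (hkappa : 0 < kappa <= 1).
Hypothesis vf : vague_intg f_ f.

(** Sharp cutoffs at a radius whose sphere is a null set for the limit measure
    are replaced by Lipschitz ones, up to the mass of a thin annulus. *)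
Lemma BL_dist_disc_cvg : exists2 N : set R, countable N & forall r, ~ N r ->
  BL_dist kappa
    (fun A : set (borel M) => image_meas (@f_ n) (A `&` disc rho r))
    (fun A : set (borel M) => image_meas f (A `&` disc rho r)) @[n --> \oo]
  --> (0 : \bar R)%E.
Proof.
pose V (r : R) := intg (((cst 1 : M -> R) \_ (disc rho r)) \o f).
have tV r : tame ((cst 1 : M -> R) \_ (disc rho r)).
  by apply: tame_disc => //; exists 1 => x; rewrite normr1.
have V_cst r x : ((cst 1 : M -> R) \_ (disc rho r)) x = (mdist rho x <= r)%R%:R.
  rewrite patchE; have [xr|xr] := leP (mdist rho x) r; first by rewrite mem_set.
  by rewrite memNset// /disc /=; apply/negP; rewrite -ltNge.
have ndV : {homo V : r s / r <= s}.
  move=> r s rs; apply: le_intg; [exact: tame_comp|exact: tame_comp|].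
  move=> x /=; rewrite !V_cst ler_nat; have [xr|//] := leP (mdist rho (f x)) r.
  by rewrite (le_trans xr rs).
exists [set r | exists2 eta : R, 0 < eta &
  forall s, 0 < s -> eta <= V (r + s) - V (r - s)]; first exact: jumps_countable.
move=> r nJ; apply/cvge0P => [n|e e0]; first exact: BL_dist_ge0.
have e40 : 0 < e / 4 by rewrite divr_gt0.
have [s s0 Vs] : exists2 s, 0 < s & V (r + 2 * s) - V (r - 2 * s) < e / 4.
  apply: contrapT => ns; apply: nJ; exists (e / 4) => // s s0.
  rewrite leNgt; apply/negP => Vs; apply: ns; exists (s / 2); first by rewrite divr_gt0.
  by have -> : 2 * (s / 2) = s by lra.
(* [psi] is a cutoff to the annulus of width [s] around the sphere of radius
   [r], and [chi] vanishes outside of [disc rho r]. *)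
pose psi (x : M) := clamp ((2 * s - `|mdist rho x - r|) / s).
pose chi (x : M) := clamp ((r - mdist rho x) / s).
have clip (x y u v : R) : `|u - v| <= `|x - y| ->
    `|clamp (u / s) - clamp (v / s)| <= s^-1 * `|x - y|.
  move=> uv; rewrite (le_trans (clamp_lip _ _))// -mulrBl normrM mulrC.
  by rewrite (gtr0_norm (x := s^-1)) ?invr_gt0// ler_pM2l ?invr_gt0.
have psi_lip x y : `|psi x - psi y| <= s^-1 * mdist x y.
  apply: le_trans (_ : s^-1 * `|mdist rho x - mdist rho y| <= _); last first.
    by rewrite ler_pM2l ?invr_gt0// mdist_sub.
  apply: clip.
  have -> : 2 * s - `|mdist rho x - r| - (2 * s - `|mdist rho y - r|) =
    `|mdist rho y - r| - `|mdist rho x - r| by lra.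
  rewrite (le_trans (ler_dist_dist _ _))// distrC.
  by have -> : mdist rho x - r - (mdist rho y - r) = mdist rho x - mdist rho y by lra.
have chi_lip x y : `|chi x - chi y| <= s^-1 * mdist x y.
  apply: le_trans (_ : s^-1 * `|mdist rho x - mdist rho y| <= _); last first.
    by rewrite ler_pM2l ?invr_gt0// mdist_sub.
  apply: clip; rewrite distrC.
  by have -> : r - mdist rho y - (r - mdist rho x) = mdist rho x - mdist rho y by lra.
have psi01 x : 0 <= psi x <= 1 by exact: clamp01.
have chi01 x : 0 <= chi x <= 1 by exact: clamp01.
have psi_supp x : psi x != 0 -> r - 2 * s < mdist rho x < r + 2 * s.
  move=> /clamp_neq0; rewrite pmulr_lgt0 ?invr_gt0// subr_gt0 ltr_norml => /andP[? ?].
  by apply/andP; split; lra.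
have chi_supp x : chi x != 0 -> mdist rho x <= r.
  by move=> /clamp_neq0; rewrite pmulr_lgt0 ?invr_gt0// subr_gt0 => /ltW.
have cpsi : continuous psi by exact: lipschitz_continuous psi_lip.
have cchi : continuous chi by exact: lipschitz_continuous chi_lip.
have spsi : bounded_support psi.
  by exists rho, (r + 2 * s) => x /psi_supp/andP[_ /ltW].
have tpsi : tame psi by exact: bounded_support_tame.
have psi_f : intg (psi \o f) < e / 4.
  apply: le_lt_trans Vs; rewrite -intgB; [|exact: tame_comp|exact: tame_comp].
  apply: le_intg; [exact: tame_comp|by apply: tameB; exact: tame_comp|].
  move=> x /=; rewrite !V_cst; have [p0|/psi_supp/andP[a1 a2]] := eqVneq (psi (f x)) 0.
    rewrite p0 subr_ge0 ler_nat; have [xr|//] := leP (mdist rho (f x)) (r - 2 * s).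
    by rewrite (le_trans xr)//; lra.
  by rewrite (ltW a2) (lt_geF a1) subr0; have /andP[] := psi01 (f x).
have hpsi := vague_intg_le vf cpsi spsi psi_f.
pose Fam := [set G : M -> R | exists2 F : M -> R, (BL_norm kappa F <= 1)%E &
  G = (fun x => F x * chi x)].
have hFam : \forall n \near \oo, forall G, Fam G ->
    `|intg (G \o @f_ n) - intg (G \o f)| <= e / 4.
  apply: (@vague_uniform _ X_ X M f_ f bM isof_ isof vf rho r Fam) => //.
  - move=> _ [F /BL_norm_le1[F1 _] ->] x.
    rewrite normrM mulr_ile1// ?F1//.
    by have /andP[? ?] := chi01 x; rewrite ger0_norm.
  - move=> _ [F _ ->] x; rewrite mulf_eq0 negb_or => /andP[_]; exact: chi_supp.
  - move=> eta eta0; have eta20 : 0 < eta / 2 by rewrite divr_gt0.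
    have [d d0 hd] := powR_kappa_lt hkappa eta20.
    exists (Num.min d (eta / 2 * s)); first by rewrite lt_min d0 mulr_gt0.
    move=> _ [F /BL_norm_le1[F1 Fk] ->] x y; rewrite lt_min => /andP[xyd xys].
    have -> : F x * chi x - F y * chi y =
      (F x - F y) * chi x + F y * (chi x - chi y) by lra.
    rewrite (le_lt_trans (ler_normD _ _))// [ltRHS]splitr ltr_leD//.
      rewrite normrM (le_lt_trans _ (hd _ (mdist_ge0 x y) xyd))//.
      rewrite -[leRHS]mulr1 ler_pM//.
      by have /andP[? ?] := chi01 x; rewrite ger0_norm.
    rewrite normrM -[leRHS]mul1r ler_pM// (le_trans (chi_lip x y))//.
    by rewrite ler_pdivrMl// mulrC ltW.
apply: filterS2 hFam hpsi => n hn psin.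
apply: ge_ereal_sup => _ [F /= BLF <-].
have [F1 Fk] := BL_norm_le1 BLF.
have cF := BL_continuous hkappa Fk.
have mF := continuous_borel_real cF.
have bF : exists B, forall x, `|F x| <= B by exists 1.
rewrite !integral_image_disc// -EFinB /= lee_fin.
have tFD : tame (F \_ (disc rho r)) by exact: tame_disc.
have tFc : tame (fun x => F x * chi x).
  apply: (@tame_continuous _ _ _ 1 rho r).
  - by move=> x; apply: cvgM; [exact: cF|exact: cchi].
  - move=> x; rewrite normrM mulr_ile1//.
    by have /andP[? ?] := chi01 x; rewrite ger0_norm.
  - by move=> x; rewrite mulf_eq0 negb_or => /andP[_]; exact: chi_supp.
have cut x : `|(F \_ (disc rho r)) x - F x * chi x| <= psi x.
  have chi0 : r < mdist rho x -> chi x = 0.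
    by move=> xr; apply: contraTeq xr => /chi_supp; rewrite -leNgt.
  rewrite patchE; have [xr|xr] := leP (mdist rho x) r; last first.
    rewrite memNset; last by rewrite /disc /=; apply/negP; rewrite -ltNge.
    by rewrite chi0// mulr0 subrr normr0; have /andP[] := psi01 x.
  rewrite mem_set//.
  have [xs|xs] := leP (mdist rho x) (r - s).
    have -> : chi x = 1 by rewrite /chi clamp1// ler_pdivlMr// mul1r; lra.
    by rewrite mulr1 subrr normr0; have /andP[] := psi01 x.
  have -> : psi x = 1.
    rewrite /psi clamp1// ler_pdivlMr// mul1r ler0_norm; last by lra.
    by lra.
  have -> : F x - F x * chi x = F x * (1 - chi x) by lra.
  rewrite normrM mulr_ile1//; have /andP[? ?] := chi01 x.
  by rewrite ger0_norm; lra.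
have est (Y : rmbc R) (g : Y -> M) : isometric g ->
    `|intg ((F \_ (disc rho r)) \o g) - intg ((fun x => F x * chi x) \o g)| <= intg (psi \o g).
  move=> isog; apply: dist_intg => [|||x]; last exact: cut.
  - exact: tame_comp.
  - exact: tame_comp.
  - exact: tame_comp.
have := est _ _ (@isof_ n); have := est _ _ isof.
have : `|intg ((fun x => F x * chi x) \o @f_ n) - intg ((fun x => F x * chi x) \o f)| <= e / 4.
  by apply: hn; exists F.
rewrite !ler_norml => /andP[? ?] /andP[? ?] /andP[? ?]; apply/andP; split; lra.
Qed.

End rooted_embedding.
End distances.

(** * Comparison of the modes of convergence *)

Section equivalence.
Context {R : realType}.
Variables (kappa : R) (hkappa : 0 < kappa <= 1).
Implicit Types X Y : rmbc R.

Lemma exp_average_ge0 (D : R -> \bar R) : (forall r, 0 <= D r)%E ->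
  (0 <= exp_average D)%E.
Proof.
move=> D0; apply: integral_ge0 => r _; rewrite mule_ge0 ?lee_fin ?expR_ge0//.
by rewrite le_min D0 lee01.
Qed.

Lemma rmbc_dist_ge0 X Y : (0 <= rmbc_dist kappa X Y)%E.
Proof.
apply: le_ereal_inf_tmp => _ [Z [rho [f [g [_ _ _ ->]]]]].
rewrite le_max; apply/orP; left; apply: exp_average_ge0 => r.
exact: hausdorff_dist_ge0.
Qed.

Lemma rooted_embedding_dist_cvg (X_ : nat -> rmbc R) X : rooted_embedding_cvg X_ X ->
  (fun n => rmbc_dist kappa (X_ n) X) @ \oo --> (0 : \bar R)%E.
Proof.
move=> [M [rho [f_ [f [bM isof_ [isof frho] cF cV]]]]].
have is_ n : isometric (f_ n) by case: (isof_ n).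
have vf : vague_intg f_ f by apply/vague_cvgP.
have [N1 cN1 h1] := hausdorff_dist_disc_cvg rho bM cF.
have [N2 cN2 h2] := BL_dist_disc_cvg rho bM is_ isof hkappa vf.
have hd0 n r := hausdorff_dist_ge0 (range (f_ n) `&` disc rho r) (range f `&` disc rho r).
have bl0 n r := BL_dist_ge0 kappa (fun A => image_meas (f_ n) (A `&` disc rho r))
  (fun A => image_meas f (A `&` disc rho r)).
have H := exp_average_cvg0 cN1 hd0 (fun r _ => h1 r).
have B := exp_average_cvg0 cN2 bl0 (fun r _ => h2 r).
apply/cvge0P => [n|e e0]; first exact: rmbc_dist_ge0.
have {}H := (cvge0P (fun n => exp_average_ge0 (hd0 n))).1 H e e0.
have {}B := (cvge0P (fun n => exp_average_ge0 (bl0 n))).1 B e e0.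
apply: filterS2 H B => n Hn Bn.
apply: (@le_trans _ _ (maxe (rooted_hausdorff_dist rho (range (f_ n)) (range f))
   (rooted_BL_dist kappa rho (image_meas (f_ n)) (image_meas f)))).
  by apply: ereal_inf_lbound; exists M, rho, (f_ n), f; split.
by rewrite ge_max; apply/andP; split; [exact: Hn|exact: Bn].
Qed.

(** A small weighted average forces the distance between the restrictions to be
    small at some radius beyond [e^-1]. Test pairs supported within that radius
    extend to the common space, since there the coupling is the distance. *)
Lemma dist_ghv_close (X_ : nat -> rmbc R) X :
  (fun n => rmbc_dist kappa (X_ n) X) @ \oo --> (0 : \bar R)%E ->
  ghv_close_cvg X_ X.
Proof.
move=> cD e e0; pose c := Num.min 1 (e / 2).
have c0 : 0 < c by rewrite lt_min ltr01 divr_gt0.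
have c1 : c <= 1 by rewrite ge_min lexx.
have ce : c <= e / 2 by rewrite ge_min lexx orbT.
have ve : 0 <= e^-1 by rewrite invr_ge0 ltW.
pose k := expR (- (e^-1 + 1)) * c.
have k20 : 0 < k / 2 by rewrite divr_gt0// mulr_gt0// expR_gt0.
have c01 : 0 < c <= 1 by rewrite c0.
have /(_ (fun n => rmbc_dist_ge0 (X_ n) X)) := @cvge0P R (fun n => rmbc_dist kappa (X_ n) X).
move=> [/(_ cD _ k20) + _]; apply: filterS => n dk.
have : (rmbc_dist kappa (X_ n) X < k%:E)%E.
  by apply: le_lt_trans dk _; rewrite lte_fin; have := k20; lra.
move=> /ereal_inf_lt[_ [Z [rho [f [g [bZ [isof frho] [isog grho] ->]]]]]].
rewrite gt_max => /andP[Hk Bk].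
have [r re /hausdorff_dist_lt[fg gf]] :=
  exp_average_lt ve c01 (fun r => hausdorff_dist_ge0 _ _) Hk.
have [r' re' BLr'] := exp_average_lt ve c01 (fun r => BL_dist_ge0 kappa _ _) Bk.
have rad1 x : mdist rho (f x) = mdist (rmbc_root (X_ n)) x by rewrite -frho isof.
have rad2 x : mdist rho (g x) = mdist (rmbc_root X) x by rewrite -grho isog.
exists (fun x y => mdist (f x) (g y)); split.
- split; first exact: isometric_coupling.
  by rewrite frho grho mdistxx.
- move=> x xe; have [|_ [[y _ <-] _] yx] := fg (f x).
    by split; [exists x|rewrite /disc /= rad1; exact: le_trans re].
  by exists y; rewrite metric_sym; lra.
- move=> y ye; have [|_ [[x _ <-] _] xy] := gf (g y).
    by split; [exists y|rewrite /disc /= rad2; exact: le_trans re].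
  by exists x; lra.
move=> phi gam tphi tgam pg.
have [phi01 lphi sphi] := tphi; have [gam01 lgam sgam] := tgam.
pose v (i : X_ n + X) := match i with inl x => phi x | inr y => gam y end.
pose D (i : X_ n + X) (z : Z) :=
  match i with inl x => mdist (f x) z | inr y => mdist (g y) z end.
have D0 i z : 0 <= D i z by case: i => [x|y]; exact: mdist_ge0.
have v1 i : v i <= 1 by case: i => [x|y]; [have /andP[] := phi01 x|have /andP[] := gam01 y].
pose F := mcshane v D.
have F01 z : 0 <= F z <= 1 by rewrite mcshane_ge0// mcshane_le1.
have lF : lipschitz1 F.
  by apply: mcshane_lipschitz1 => // -[x|y] z z'; exact: metric_triangle.
have Ff x : F (f x) = phi x.
  apply/eqP; rewrite eq_le; apply/andP; split.
    apply: mcshane_le => [|[x'|y] /=]; first by have /andP[] := phi01 x.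
      by have := lphi x' x; rewrite isof ler_norml => /andP[]; lra.
    by have := pg x y; rewrite metric_sym ler_norml => /andP[]; lra.
  by have := @mcshane_ge _ _ _ v D D0 v1 (inl x) (f x); rewrite /= mdistxx subr0.
have Fg y : F (g y) = gam y.
  apply/eqP; rewrite eq_le; apply/andP; split.
    apply: mcshane_le => [|[x|y'] /=]; first by have /andP[] := gam01 y.
      by have := pg x y; rewrite ler_norml => /andP[]; lra.
    by have := lgam y' y; rewrite isog ler_norml => /andP[]; lra.
  by have := @mcshane_ge _ _ _ v D D0 v1 (inr y) (g y); rewrite /= mdistxx subr0.
have BLF := lipschitz_BL_norm hkappa lF F01.
pose F2 z := 2^-1 * F z.
have mF2 : measurable_fun [set: borel Z] (F2 : borel Z -> R).
  apply: continuous_borel_real => z; apply: cvgM; first exact: cvg_cst.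
  exact: lipschitz1_continuous lF _.
have bF2 : exists B, forall z, `|F2 z| <= B.
  by exists 1 => z; have /andP[? ?] := F01 z; rewrite /F2 ger0_norm; lra.
have restr (Y : rmbc R) (h : Y -> Z) (gamma : Y -> R) : isometric h ->
    h (rmbc_root Y) = rho -> test e gamma -> (forall y, F (h y) = gamma y) ->
    intg ((F2 \_ (disc rho r')) \o h) = 2^-1 * intg gamma.
  move=> isoh hrho tgamma Fh; rewrite -intgZ; last exact: test_tame tgamma.
  congr intg; apply/funext => y /=; rewrite patchE /F2 Fh; case: ifPn => //.
  rewrite notin_setE /disc /= -hrho isoh => /negP yr'.
  have -> : gamma y = 0.
    apply: contraNeq yr'; case: tgamma => _ _ /(_ y) /[apply] /le_trans; exact.
  by rewrite mulr0.
have : (`|\int[fun A : set (borel Z) => image_meas f (A `&` disc rho r')]_z (F2 z)%:E -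
         \int[fun A : set (borel Z) => image_meas g (A `&` disc rho r')]_z (F2 z)%:E|
        < c%:E)%E.
  by apply: le_lt_trans BLr'; apply: ereal_sup_ubound; exists F2.
rewrite !integral_image_disc// -EFinB /= lte_fin.
rewrite (restr _ f phi)// (restr _ g gam)// -mulrBr normrM ger0_norm ?invr_ge0//.
by lra.
Qed.

(** Open sets of the Gromov-Hausdorff-vague topology must be invariant under
    equivalence; this follows once equivalent spaces are limits of each other,
    for which the ambient space can be [Y] itself. *)
Lemma equiv_embedding_cvg X Y : rmbc_equiv X Y -> embedding_cvg (fun=> Y) X.
Proof.
move=> [h [isoh rh hroot hmeas]].
exists Y, (fun=> id), h; split.
- exact: rmbc_bc.
- by split=> // n x y.
- rewrite (_ : range h = range (id : Y -> Y)); first exact: cvg_cst.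
  by rewrite rh; apply/seteqP; split=> // y _; exists y.
- rewrite hroot; exact: cvg_cst.
- move=> phi cphi sphi.
  suff -> : (\int[image_meas h]_x (phi x)%:E = \int[image_meas (id : Y -> Y)]_x (phi x)%:E)%E.
    exact: cvg_cst.
  have mh := continuous_borel (isometric_continuous isoh).
  apply: (@eq_measure_integral _ _ _ setT (rmbc_meas Y)
     (pushforward (rmbc_meas X) (h : borel X -> borel Y)) (fun x => (phi x)%:E)).
  by move=> A mA _; exact: hmeas.
Qed.

(** The endpoints of chains issued from [X] form a neighborhood of [X]: the last
    point of a chain being approached by a sequence in a common space, the
    members of the sequence eventually are endpoints of longer chains. *)
Lemma GHv_ghv_close (X_ : nat -> rmbc R) X : X_ @ \oo --> X -> ghv_close_cvg X_ X.
Proof.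
move=> cX e e0; pose s := Num.min 1 e.
have s0 : 0 < s by rewrite lt_min ltr01.
have s1 : s <= 1 by rewrite ge_min lexx.
have se : s <= e by rewrite ge_min lexx orbT.
pose U := [set Y | exists k, chain k s X Y].
have oU : GHv_open U.
  split=> [Y Y' YY' [k hk]|Y_ Y [k hk] cY].
    have h : 0 < s / 2 ^+ k.+1 by rewrite divr_gt0// exprn_gt0.
    have [n _ hn] := embedding_ghv_close (equiv_embedding_cvg YY') h.
    by exists k.+1; apply: chain_rcons hk _; exact: (hn n (leqnn n)).
  have h : 0 < s / 2 ^+ k.+1 by rewrite divr_gt0// exprn_gt0.
  have := embedding_ghv_close cY h; apply: filterS => n hn.
  by exists k.+1; exact: chain_rcons hk hn.
have UX : nbhs X U.
  by apply: (open_nbhs_nbhs (A := U)); split; [exact: oU|exists 0].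
have nU : \forall n \near \oo, U (X_ n) by exact: cX UX.
apply: filterS nU => n [k hk].
by apply: (ghv_close_le s0 se); exact: (chain_ghv_close s0 s1 hk).
Qed.

Lemma rooted_embedding_embedding (X_ : nat -> rmbc R) X :
  rooted_embedding_cvg X_ X -> embedding_cvg X_ X.
Proof.
move=> [M [rho [f_ [f [bM isof_ [isof frho] cF cV]]]]].
exists M, f_, f; split=> //; first by split=> // n; case: (isof_ n).
rewrite frho; under eq_fun do rewrite (isof_ _).2.
exact: cvg_cst.
Qed.

Lemma embedding_GHv_cvg (X_ : nat -> rmbc R) X : embedding_cvg X_ X -> X_ @ \oo --> X.
Proof.
move=> cX U; rewrite nbhsE => -[V [oV VX] VU].
by apply: filterS VU _; have [_ h] : GHv_open V by []; exact: h cX.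
Qed.

End equivalence.

Theorem theorem2p31 (R : realType) (kappa : R) (hkappa : 0 < kappa <= 1)
    (X_ : nat -> rmbc R) (X : rmbc R) :
  [<-> rooted_embedding_cvg X_ X;
       embedding_cvg X_ X;
       (fun n => rmbc_dist kappa (X_ n) X) @ \oo --> (0 : \bar R)%E;
       X_ @ \oo --> X].
Proof.
tfae.
- exact: rooted_embedding_embedding.
- move=> /embedding_ghv_close /ghv_close_rooted_embedding.
  exact: rooted_embedding_dist_cvg.
- move=> /(dist_ghv_close hkappa) /ghv_close_rooted_embedding.
  by move=> /rooted_embedding_embedding; exact: embedding_GHv_cvg.
- by move=> /GHv_ghv_close; exact: ghv_close_rooted_embedding.
Qed.
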